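(* Let $p$ be a prime. Then the positive existential theory $\mathrm{Th}_{\exists^+}(\mathbb{N};0,1,+,|_p,\leq)$ is undecidable, where $|_p$ is the binary relation on $\mathbb{N}$ defined by $a|_p b \iff \exists s\in\mathbb{N}\ (b=p^s a \lor a=p^s b)$.
   Context: $\mathrm{Th}_{\exists^+}$ denotes the set of positive existential sentences (existentially quantified positive Boolean combinations of atomic formulas) true in the structure $(\mathbb{N};0,1,+,|_p,\leq)$; undecidable means this set is not recursive. *)

(* Defs.v *)
From mathcomp Require Import all_boot.

Set Implicit Arguments.
Unset Strict Implicit.
Unset Printing Implicit Defensive.

Inductive recfun : nat -> Type :=
| RZero n : recfun n
| RSucc : recfun 1
| RProj n (i : 'I_n) : recfun n
| RComp k n (f : recfun k) (g : 'I_k -> recfun n) : recfun n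
| RPrec n (f : recfun n) (g : recfun n.+2) : recfun n.+1
| RMu n (f : recfun n.+1) : recfun n.

(** [rec_graph f v r] means that [f] is defined at [v] with value [r].
    Primitive recursion and minimization act on the first argument; in the
    recursion step [g] receives the counter, the previous value, and then the
    parameters. *)
Fixpoint rec_graph n (f : recfun n) : n.-tuple nat -> nat -> Prop :=
  match f in recfun n return n.-tuple nat -> nat -> Prop with
  | RZero n => fun _ r => r = 0
  | RSucc => fun v r => r = (thead v).+1
  | RProj n i => fun v r => r = tnth v i
  | RComp k n f g => fun v r =>
      exists w : k.-tuple nat,
        (forall i, rec_graph (g i) v (tnth w i)) /\ rec_graph f w r
  | RPrec n f g => fun v r =>
      let w : n.-tuple nat := [tuple of behead v] in
      exists h : nat -> nat,
        [/\ rec_graph f w (h 0),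
            forall i, i < thead v ->
              rec_graph g [tuple of i :: h i :: w] (h i.+1)
          & r = h (thead v)]
  | RMu n f => fun v r =>
      rec_graph f [tuple of r :: v] 0 /\
      forall i, i < r -> exists m, rec_graph f [tuple of i :: v] m.+1
  end.

Lemma rec_graph_fun n (f : recfun n) v r1 r2 :
  rec_graph f v r1 -> rec_graph f v r2 -> r1 = r2.
Proof.
elim: f v r1 r2 => {n} [n|| n i | k n f IHf g IHg | n f IHf g IHg | n f IHf]
  v r1 r2 /=; try by move=> -> ->.
- move=> [w1 [gw1 fw1]] [w2 [gw2 fw2]].
  have w12 : w1 = w2 by apply: eq_from_tnth => i; apply: (IHg i v).
  by move: fw1; rewrite w12 => fw1; apply: (IHf w2).
- move=> [h1 [f1 g1 ->]] [h2 [f2 g2 ->]].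
  have: forall i, i <= thead v -> h1 i = h2 i; last by move/(_ _ (leqnn _)).
  elim=> [_|i IHi lti]; first exact: IHf f1 f2.
  have h12 := IHi (ltnW lti).
  by have := g1 i lti; rewrite h12 => g1i; apply: IHg g1i (g2 i lti).
- move=> [f1 lt1] [f2 lt2]; case: (ltngtP r1 r2) => // lt12.
  + by have [m /IHf /(_ f1)] := lt2 _ lt12.
  + by have [m /IHf /(_ f2)] := lt1 _ lt12.
Qed.

(** The characteristic function of [A] is (total) recursive. *)
Definition recursive_set (A : nat -> Prop) : Prop :=
  exists f : recfun 1, forall n : nat,
    (A n -> rec_graph f [tuple n] 1) /\ (~ A n -> rec_graph f [tuple n] 0).

Inductive term (k : nat) : Type :=
| TVar of 'I_k
| TZero
| TOne
| TAdd of term k & term k.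

Inductive posform (k : nat) : Type :=
| PEq of term k & term k
| PDiv of term k & term k
| PLe of term k & term k
| PAnd of posform k & posform k
| POr of posform k & posform k.

Arguments TZero {k}.
Arguments TOne {k}.

(** [PosEx k phi] is the sentence (exists x_0 ... x_(k-1), phi). *)
Record posex_sentence : Type := PosEx {
  nvars : nat;
  matrix : posform nvars
}.

Definition divp (p a b : nat) : Prop :=
  exists s : nat, b = p ^ s * a \/ a = p ^ s * b.

Fixpoint term_val k (v : 'I_k -> nat) (t : term k) : nat :=
  match t with
  | TVar i => v i
  | TZero => 0
  | TOne => 1
  | TAdd t u => term_val v t + term_val v u
  end.

Fixpoint sat (p k : nat) (v : 'I_k -> nat) (phi : posform k) : Prop :=
  match phi with
  | PEq t u => term_val v t = term_val v u
  | PDiv t u => divp p (term_val v t) (term_val v u)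
  | PLe t u => term_val v t <= term_val v u
  | PAnd phi psi => sat p v phi /\ sat p v psi
  | POr phi psi => sat p v phi \/ sat p v psi
  end.

Definition Th_posex (p : nat) (s : posex_sentence) : Prop :=
  exists v : 'I_(nvars s) -> nat, sat p v (matrix s).

Definition cpair (a b : nat) : nat := ((a + b) * (a + b).+1)./2 + b.

Fixpoint term_code k (t : term k) : nat :=
  match t with
  | TVar i => cpair 0 i
  | TZero => cpair 1 0
  | TOne => cpair 2 0
  | TAdd t u => cpair 3 (cpair (term_code t) (term_code u))
  end.

Fixpoint posform_code k (phi : posform k) : nat :=
  match phi with
  | PEq t u => cpair 0 (cpair (term_code t) (term_code u))
  | PDiv t u => cpair 1 (cpair (term_code t) (term_code u))
  | PLe t u => cpair 2 (cpair (term_code t) (term_code u))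
  | PAnd phi psi => cpair 3 (cpair (posform_code phi) (posform_code psi))
  | POr phi psi => cpair 4 (cpair (posform_code phi) (posform_code psi))
  end.

Definition sentence_code (s : posex_sentence) : nat :=
  cpair (nvars s) (posform_code (matrix s)).

Lemma cpair_inj a b c d : cpair a b = cpair c d -> a = c /\ b = d.
Proof.
have tri n : (n.+1 * n.+2)./2 = (n * n.+1)./2 + n.+1.
  have -> : n.+1 * n.+2 = n * n.+1 + n.+1.*2.
    by rewrite -muln2 (mulnC n) -mulnDr addn2.
  by rewrite halfD odd_double andbF doubleK.
have tri_mono m n : m <= n -> (m * m.+1)./2 <= (n * n.+1)./2.
  by move=> le_mn; rewrite half_leq // leq_mul.
have lt_tri a1 b1 c1 d1 : a1 + b1 < c1 + d1 -> cpair a1 b1 < cpair c1 d1.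
  move=> lt_s; apply: leq_trans (leq_addr _ _).
  apply: leq_trans (tri_mono _ _ lt_s).
  by rewrite tri /cpair ltn_add2l ltnS leq_addl.
move=> eq_p; case: (ltngtP (a + b) (c + d)) => [/lt_tri|/lt_tri|eq_s].
- by rewrite eq_p ltnn.
- by rewrite eq_p ltnn.
move: eq_p; rewrite /cpair eq_s => /addnI eq_bd.
by split=> //; move: eq_s; rewrite eq_bd => /addIn.
Qed.

Lemma term_code_inj k : injective (@term_code k).
Proof.
elim=> [i|||t IHt u IHu] [j|||t' u'] /= /cpair_inj [] //.
- by move=> _ /val_inj ->.
- by move=> _ /cpair_inj [/IHt -> /IHu ->].
Qed.

Lemma posform_code_inj k : injective (@posform_code k).
Proof.
elim=> [t u|t u|t u|phi IHphi psi IHpsi|phi IHphi psi IHpsi]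
  [t' u'|t' u'|t' u'|phi' psi'|phi' psi'] /= /cpair_inj [] // _ /cpair_inj [];
  by [move=> /term_code_inj -> /term_code_inj -> | move=> /IHphi -> /IHpsi ->].
Qed.

Lemma sentence_code_inj : injective sentence_code.
Proof.
move=> [k phi] [l psi] /cpair_inj /= [eq_kl].
by case: l / eq_kl psi => psi /posform_code_inj ->.
Qed.

Definition undecidable (T : posex_sentence -> Prop) : Prop :=
  ~ recursive_set (fun c => exists2 s, T s & sentence_code s = c).

(* Main.v *)
Require Import Defs.
From mathcomp Require Import all_boot ssralg ssrnum ssrint zify ring.
From Stdlib Require Import FunctionalExtensionality.

(** Every relation computed by a [recfun] is positive existentially definable
    from [+] and [divp], and a decision procedure for the theory could then be
    diagonalised against: apply the formula saying "the procedure rejects the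
    instance of the sentence [c] at its own code [c]" to its own code.

    Multiplication by a power of [p] is definable.  If [P] and [Q = P ^ s] are powers of [p] and [D = P - 1], then
    [(Q - 1) / D = s + D s (s - 1) / 2] modulo [D ^ 2]; comparing this with the
    same congruence for [P ^ 2] and [Q ^ 2] forces [t = k ^ 2] whatever [s] is,
    hence multiplication is definable.  Exponentiation [P ^ k] then follows from
    a Lucas sequence [a] with parameter congruent to [2] modulo [Q - 1] and to
    [P + 1 / P] modulo a divisor [C] of [R + 1], where [(Q - 1) ^ 2] divides
    [R - 1]: the index [l] of a term is visible as [a_l = l] modulo [Q - 1] and
    as [P ^ l] modulo [C].  Exponentiation gives binomial coefficients, and
    these, by Kummer's theorem, the digitwise order [dom] in base [p].
    Over [1, +, *, dom] bounded universal quantifiers can be eliminated from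
    conjunctive existential formulas: the values of each variable are packed
    into one number, on which [+] and [dom] act digitwise, and the digitwise
    product is read off from an ordinary product in sparser bases.  Primitive
    recursion and minimisation only need bounded quantifiers. *)

Set Implicit Arguments.
Unset Strict Implicit.
Unset Printing Implicit Defensive.

(** * Positive existential conjunctive definability *)

Definition env := nat -> nat.

(** * Systems of atoms and closure properties of definability *)

Definition mix (a b : env) : env := fun i => if odd i then b i./2 else a i./2.

Lemma mix_even a b : (fun i => mix a b i.*2) = a.
Proof.
by apply: functional_extensionality => i; rewrite /mix odd_double doubleK.
Qed.

Lemma mix_odd a b : (fun i => mix a b i.*2.+1) = b.
Proof.
by apply: functional_extensionality => i; rewrite /mix /= odd_double uphalf_double.
Qed.

Definition scons (x : nat) (v : env) : env := fun i => if i is j.+1 then v j else x.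

Section Definability.

Variables (K : Type) (I : K -> nat -> nat -> nat -> Prop).

(* [inl i] is the [i]-th parameter, [inr j] the [j]-th quantified variable. *)
Definition var := (nat + nat)%type.
Definition atom := (K * (var * var * var))%type.

Definition join (v e : env) : var -> nat :=
  fun x => match x with inl i => v i | inr j => e j end.

Definition atom_holds (w : var -> nat) (a : atom) : Prop :=
  let: (k, (x, y, z)) := a in I k (w x) (w y) (w z).

Definition holds (w : var -> nat) (S : seq atom) : Prop :=
  foldr (fun a P => atom_holds w a /\ P) True S.

(** The witness is a whole environment, of which the finite list [S] reads only finitely many
    entries. *)
Definition definable (P : env -> Prop) : Prop :=
  exists S, forall v, P v <-> exists e, holds (join v e) S.

Definition atom_map (f : var -> var) (a : atom) : atom :=
  let: (k, (x, y, z)) := a in (k, (f x, f y, f z)).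

Lemma holds_map w f S :
  holds w (map (atom_map f) S) <-> holds (fun x => w (f x)) S.
Proof. by elim: S => //= -[k [[x y] z]] S IH /=; rewrite IH. Qed.

Lemma holds_cat w S1 S2 : holds w (S1 ++ S2) <-> holds w S1 /\ holds w S2.
Proof. by elim: S1 => /= [|a S IH]; [tauto | rewrite IH; tauto]. Qed.

Lemma holds_ext w w' S : w =1 w' -> holds w S -> holds w' S.
Proof. by move=> /functional_extensionality ->. Qed.

Definition var_index (x : var) : nat := match x with inl i | inr i => i end.

Fixpoint vars_lt m (S : seq atom) : Prop :=
  if S is (k, (x, y, z)) :: S' then
    [/\ var_index x < m, var_index y < m & var_index z < m] /\ vars_lt m S'
  else True.

Lemma vars_lt_exists S : exists m, vars_lt m S.
Proof.
have widen m m' T : m <= m' -> vars_lt m T -> vars_lt m' T.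
  move=> mm'; elim: T => [|[k [[x y] z]] T IH] //= [[hx hy hz] hT].
  by split; [split; lia | apply: IH].
elim: S => [|[k [[x y] z]] S [m hm]]; first by exists 0.
exists (maxn m (maxn (var_index x) (maxn (var_index y) (var_index z))).+1).
by split; [split; lia | apply: widen hm; lia].
Qed.

Lemma holds_vars_lt m w w' S : vars_lt m S ->
  (forall x, var_index x < m -> w x = w' x) -> holds w S -> holds w' S.
Proof.
move=> + eqw; elim: S => [|[k [[x y] z]] S IH] //= [[hx hy hz] hS] [ha h].
by split; [rewrite -!eqw | apply: IH].
Qed.

Lemma definable_ext (P Q : env -> Prop) :
  (forall v, Q v <-> P v) -> definable P -> definable Q.
Proof. by move=> PQ [S hS]; exists S => v; rewrite PQ. Qed.

Lemma definable_true : definable (fun=> True).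
Proof. by exists [::] => v; split=> // _; exists v. Qed.

Lemma definable_atom k i j l : definable (fun v => I k (v i) (v j) (v l)).
Proof.
exists [:: (k, (inl i, inl j, inl l))] => v /=.
by split=> [h|[e []//]]; exists v.
Qed.

Lemma definable_and P Q :
  definable P -> definable Q -> definable (fun v => P v /\ Q v).
Proof.
move=> [S hS] [S' hS'].
pose f (x : var) : var := match x with inl i => inl i | inr j => inr j.*2 end.
pose g (x : var) : var := match x with inl i => inl i | inr j => inr j.*2.+1 end.
exists (map (atom_map f) S ++ map (atom_map g) S') => v.
rewrite hS hS'; split=> [[[e he] [e' he']]|[e]].
- exists (mix e e'); rewrite holds_cat !holds_map; split.
  + by apply: holds_ext he => -[i|j] //=; rewrite /mix odd_double doubleK.
  + apply: holds_ext he' => -[i|j] //=.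
    by rewrite /mix /= odd_double uphalf_double.
- rewrite holds_cat !holds_map => -[he he']; split.
  + by exists (fun j => e j.*2); apply: holds_ext he => -[].
  + by exists (fun j => e j.*2.+1); apply: holds_ext he' => -[].
Qed.

Lemma definable_rename (s : nat -> nat) P :
  definable P -> definable (fun v => P (fun i => v (s i))).
Proof.
move=> [S hS].
pose f (x : var) : var := match x with inl i => inl (s i) | inr j => inr j end.
exists (map (atom_map f) S) => v; rewrite hS.
by split=> -[e he]; exists e; move: he; rewrite holds_map;
  apply: holds_ext => -[].
Qed.

(** Quantifies a whole block of variables at once: even indices carry the parameters, odd ones the
    variables that move to the quantified side. *)
Lemma definable_exs (P : env -> env -> Prop) :
  definable (fun v => P (fun i => v i.*2) (fun i => v i.*2.+1)) ->
  definable (fun v => exists e, P v e).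
Proof.
move=> [S hS].
pose f (x : var) : var := match x with
  | inl i => if odd i then inr i./2.*2 else inl i./2
  | inr j => inr j.*2.+1 end.
exists (map (atom_map f) S) => v.
have key d e : holds (join (mix v d) e) S <->
               holds (join v (mix d e)) (map (atom_map f) S).
  rewrite holds_map.
  have fE : join (mix v d) e =1 (fun x => join v (mix d e) (f x)).
    case=> [i|j] /=; rewrite /mix /=; last by rewrite odd_double uphalf_double.
    by case: ifP => //= _; rewrite odd_double doubleK.
  by split; apply: holds_ext.
have hP d : P v d <-> exists e, holds (join (mix v d) e) S.
  by rewrite -hS mix_even mix_odd.
split=> [[d /hP [e /key he]]|[e he]]; first by exists (mix d e).
exists (fun i => e i.*2); apply/hP; exists (fun i => e i.*2.+1); apply/key.
apply: holds_ext he => -[i|j] //=; rewrite /mix -{1}[j]odd_double_half.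
by case: (odd j).
Qed.

Lemma definable_ex (P : nat -> env -> Prop) :
  definable (fun v => P (v 0) (fun i => v i.+1)) ->
  definable (fun v => exists x, P x v).
Proof.
move=> dP; apply: (@definable_ext (fun v => exists e : env, P (e 0) v)).
  by move=> v; split=> [[x hx]|[e he]]; [exists (fun=> x) | exists (e 0)].
apply: definable_exs.
exact: (@definable_rename (fun i => if i is j.+1 then j.*2 else 1) _ dP).
Qed.

Lemma definable_forall_lt m (P : nat -> env -> Prop) :
  (forall i, definable (P i)) -> definable (fun v => forall i, i < m -> P i v).
Proof.
move=> dP; elim: m => [|m IH].
  by apply: definable_ext definable_true => v; split.
apply: definable_ext (definable_and IH (dP m)) => v; split=> [h|[h hm] i].
  by split=> [i lt_im|]; apply: h; lia.
by rewrite ltnS leq_eqVlt => /orP[/eqP -> //|]; apply: h.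
Qed.

Definition defterm (t : env -> nat) : Prop :=
  definable (fun v => v 0 = t (fun i => v i.+1)).

(** Only parameters below some [m] occur in [S], so a conjunction of finitely many graphs of terms
    suffices. *)
Lemma definable_subst (P : env -> Prop) (t : nat -> env -> nat) :
  definable P -> (forall i, defterm (t i)) -> definable (fun v => P (fun i => t i v)).
Proof.
move=> dP dt; have [S hS] := dP; have [m hm] := vars_lt_exists S.
apply: (@definable_ext
  (fun v => exists d : env, (forall i, i < m -> d i = t i v) /\ P d)).
- move=> v; split=> [h|[d [hd /hS [e he]]]].
    by exists (fun i => t i v).
  by apply/hS; exists e; apply: (holds_vars_lt hm) he => -[i|j] //= /hd.
- apply: definable_exs; apply: definable_and; last first.
    exact: definable_rename dP.
  apply: definable_forall_lt => i.
  exact: (@definable_rename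
    (fun j => if j is k.+1 then k.*2 else i.*2.+1) _ (dt i)).
Qed.

End Definability.

(** Change of signature, by replacing each atom of the system by its definition. *)
Lemma definable_trans K I K' I' (P : env -> Prop) :
  (forall k, @definable K' I' (fun v => I k (v 0) (v 1) (v 2))) ->
  @definable K I P -> definable I' P.
Proof.
move=> dI [S hS]; apply: definable_ext hS _; apply: definable_exs.
elim: S => [|[k [[x y] z]] S IH] /=; first exact: definable_true.
apply: definable_and IH.
pose f (x : var) := match x with inl i => i.*2 | inr j => j.*2.+1 end.
have fE v u : join (fun i => v i.*2) (fun i => v i.*2.+1) u = v (f u).
  by case: u.
pose s i := if i is 0 then f x else if i is 1 then f y else f z.
apply: definable_ext (definable_rename s (dI k)) => v.
by rewrite !fE.
Qed.

(** * Terms over signatures containing addition and one *)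

Class additive K (I : K -> nat -> nat -> nat -> Prop) : Prop := Additive {
  definable_var_add : definable I (fun v => v 0 + v 1 = v 2);
  definable_var_one : definable I (fun v => v 0 = 1)
}.

Section Additive.

Variables (K : Type) (I : K -> nat -> nat -> nat -> Prop).
Context {addI : additive I}.

Lemma term_var i : defterm I (fun v => v i).
Proof.
(* [z + z = z] forces [z = 0], so adding [z] expresses equality through the addition atom alone. *)
apply: (@definable_ext _ _ (fun v => exists z, z + z = z /\ z + v i.+1 = v 0)).
  by move=> v; split=> [->|[z [hz <-]]]; [exists 0 | lia].
apply: definable_ex; apply: definable_and.
  exact: (definable_rename (fun=> 0) definable_var_add).
exact: (definable_rename
  (fun j => if j is 0 then 0 else if j is 1 then i.+2 else 1) definable_var_add).
Qed.

Lemma definable_app1 (R : nat -> Prop) t :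
  definable I (fun v => R (v 0)) -> defterm I t -> definable I (fun v => R (t v)).
Proof.
move=> dR dt; exact: (definable_subst (t := fun=> t) dR (fun=> dt)).
Qed.

Lemma definable_app2 (R : nat -> nat -> Prop) t u :
  definable I (fun v => R (v 0) (v 1)) -> defterm I t -> defterm I u ->
  definable I (fun v => R (t v) (u v)).
Proof.
move=> dR dt du.
by apply: (definable_subst
  (t := fun i => if i is 0 then t else u) dR) => -[|i].
Qed.

Lemma definable_app3 (R : nat -> nat -> nat -> Prop) t u r :
  definable I (fun v => R (v 0) (v 1) (v 2)) -> defterm I t -> defterm I u ->
  defterm I r -> definable I (fun v => R (t v) (u v) (r v)).
Proof.
move=> dR dt du dr.
by apply: (definable_subst
  (t := fun i => if i is 0 then t else if i is 1 then u else r) dR)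
  => -[|[|i]].
Qed.

Lemma term_app1 (f : nat -> nat) t :
  definable I (fun v => v 0 = f (v 1)) -> defterm I t -> defterm I (fun v => f (t v)).
Proof.
move=> df dt.
apply: (@definable_app2 (fun x y => x = f y) (fun v => v 0)
  (fun v => t (fun i => v i.+1))) => //; first exact: term_var.
exact: (definable_rename (fun i => if i is j.+1 then j.+2 else 0) dt).
Qed.

Lemma term_app2 (f : nat -> nat -> nat) t u :
  definable I (fun v => v 0 = f (v 1) (v 2)) -> defterm I t -> defterm I u ->
  defterm I (fun v => f (t v) (u v)).
Proof.
move=> df dt du.
apply: (@definable_app3 (fun x y z => x = f y z) (fun v => v 0)
  (fun v => t (fun i => v i.+1)) (fun v => u (fun i => v i.+1))) => //.
- exact: term_var.
- exact: (definable_rename (fun i => if i is j.+1 then j.+2 else 0) dt).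
- exact: (definable_rename (fun i => if i is j.+1 then j.+2 else 0) du).
Qed.

Lemma term_app3 (f : nat -> nat -> nat -> nat) t u r :
  definable I (fun v => v 0 = f (v 1) (v 2) (v 3)) ->
  defterm I t -> defterm I u -> defterm I r ->
  defterm I (fun v => f (t v) (u v) (r v)).
Proof.
move=> df dt du dr.
pose sh (t : env -> nat) (v : env) := t (fun i => v i.+1).
have dsh s : defterm I s -> defterm I (sh s).
  exact: (definable_rename (fun i => if i is j.+1 then j.+2 else 0)).
apply: (definable_subst (t := fun i => if i is 0 then (fun v => v 0)
  else if i is 1 then sh t else if i is 2 then sh u else sh r) df).
by case=> [|[|[|i]]]; [apply: term_var | apply: dsh ..].
Qed.

Lemma definable_eq t u :
  defterm I t -> defterm I u -> definable I (fun v => t v = u v).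
Proof.
move=> dt du.
exact: (definable_app2 (R := fun x y => x = y) (term_var 0) dt du).
Qed.

Lemma term_add t u : defterm I t -> defterm I u -> defterm I (fun v => t v + u v).
Proof.
apply: term_app2.
apply: (@definable_ext _ _ (fun v => v 1 + v 2 = v 0)) => [v|].
  by split=> ->.
exact: (definable_rename
  (fun j => if j is 0 then 1 else if j is 1 then 2 else 0) definable_var_add).
Qed.

Lemma term_const c : defterm I (fun=> c).
Proof.
elim: c => [|c IH].
  apply: (@definable_ext _ _ (fun v => v 0 + v 0 = v 0)) => [v|]; first lia.
  exact: (definable_rename (fun=> 0) definable_var_add).
apply: (@definable_ext _ _ (fun v => v 0 = c + 1)) => [v|].
  by rewrite addn1.
exact: (term_add (t := fun=> c) (u := fun=> 1) IH definable_var_one).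
Qed.

Lemma term_succ t : defterm I t -> defterm I (fun v => (t v).+1).
Proof.
move=> dt; have := term_add dt (term_const 1).
by apply: definable_ext => v; rewrite addn1.
Qed.

Lemma definable_le t u : defterm I t -> defterm I u -> definable I (fun v => t v <= u v).
Proof.
apply: (@definable_app2 (fun x y => x <= y)).
apply: (@definable_ext _ _ (fun v => exists z, v 0 + z = v 1)).
  move=> v; split=> [h|[z <-]]; last exact: leq_addr.
  by exists (v 1 - v 0); rewrite subnKC.
apply: definable_ex.
by apply: definable_eq; [apply: term_add|]; apply: term_var.
Qed.

End Additive.

(** An extension point: later sections redefine [def_hook] to teach [def_tac] the operations shown
    definable so far. *)
Ltac def_hook := fail.

Ltac def_step := cbv beta; match goal with
  | |- definable _ (fun v => _ /\ _) => refine (definable_and _ _)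
  | |- definable _ (fun v => exists x : nat, _) => refine (definable_ex _)
  | |- definable _ (fun v => @eq nat _ _) => refine (definable_eq _ _)
  | |- definable _ (fun v => is_true (leq _ _)) => refine (definable_le _ _)
  | |- defterm _ (fun v => v _) => exact (term_var _)
  | |- defterm _ (fun v => addn _ _) => refine (term_add _ _)
  | |- defterm _ (fun v => S _) => refine (term_succ _)
  | |- defterm _ (fun v => ?c) => exact (term_const c)
  | |- _ => def_hook
  end.
Ltac def_tac := repeat def_step.

(** * Squares from powers of p *)

Definition ppow (p x : nat) : Prop := exists s, x = p ^ s.

Lemma ppow_exp p x k : ppow p x -> ppow p (x ^ k).
Proof. by case=> s ->; exists (s * k); rewrite expnM. Qed.

Lemma ppow_gt0 p x : 0 < p -> ppow p x -> 0 < x.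
Proof. by move=> p0 [s ->]; rewrite expn_gt0 p0. Qed.

Lemma ppow_ge p m : 1 < p -> exists2 P, ppow p P & m < P.
Proof. by move=> p1; exists (p ^ m); [exists m | apply: ltn_expl]. Qed.

(** The equation says that [P - 1] divides [Q - 1] with quotient [a]. It passes to [Q / P] and
    [a / P], so factors [P] can be peeled off until [Q = 1]. *)
Lemma ppow_eq_exp p P Q a : 1 < p -> 1 < P -> ppow p P -> ppow p Q ->
  a * P + 1 = Q + a -> exists s, Q = P ^ s.
Proof.
move=> p1 P1 [n defP] [m defQ].
elim/ltn_ind: a Q m defQ => -[|a] IH Q m defQ eqQ.
  by exists 0; rewrite expn0; lia.
have le_nm : n <= m by rewrite -(leq_exp2l _ _ p1) -defP -defQ; nia.
have eqPQ : Q = P * p ^ (m - n) by rewrite defP -expnD subnKC.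
have /dvdnP [b eqb] : P %| a.
  have : P %| P * p ^ (m - n) + a by apply/dvdnP; exists a.+1; lia.
  by rewrite dvdn_addr // dvdn_mulr.
have [s es] : exists s, p ^ (m - n) = P ^ s.
  by apply: (IH b _ _ (m - n)) => //; nia.
rewrite eqPQ es.
by exists s.+1; rewrite expnS.
Qed.

Section Squares.

Local Open Scope ring_scope.
Import GRing.Theory.

(** The binomial expansion modulo [D ^ 2], and modulo [D ^ 3] after doubling, which avoids the half
    in [s (s - 1) / 2]. *)
Lemma exp_expansion (D : int) s : exists2 y, (1 + D) ^+ s = 1 + s%:Z * D + y * D ^+ 2
  & exists z, 2 * (1 + D) ^+ s =
      2 + 2 * s%:Z * D + s%:Z * (s%:Z - 1) * D ^+ 2 + z * D ^+ 3.
Proof.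
elim: s => [|s [y eqy [z eqz]]].
  by exists 0; [ring | exists 0; ring].
have -> : s.+1%:Z = s%:Z + 1 by lia.
exists (y + s%:Z + y * D); first by rewrite exprS eqy; ring.
exists (z + s%:Z * (s%:Z - 1) + z * D).
transitivity ((1 + D) * (2 * (1 + D) ^+ s)); first by rewrite exprS; ring.
by rewrite eqz; ring.
Qed.

End Squares.

(* With [Q = P ^ s] and [D = P - 1], the first two equations read
   [s = k] modulo [D], and the last one [k ^ 2 = t] modulo [D] up to twice
   the quotient of [s - k] by [D]. *)
Definition square_cert (P Q k t a g w : nat) : Prop :=
  [/\ a * P + 1 = Q + a, a + g = k + g * P & g + g + k + w = t + w * P].

(** Here [a = (P ^ s - 1) / D]. Its first-order expansion gives [s = k + u D] with [u = g - y]; the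
    second-order one gives [2 g = 2 u + s (s - 1)] modulo [D], and [t = 2 g + k]. *)
Lemma square_cert_sound P s k t a g w : 1 < P -> square_cert P (P ^ s) k t a g w ->
  exists u y : int, (s%:Z = k%:Z + u * (P%:Z - 1) /\
                     t%:Z = k%:Z * k%:Z + 2 * u + y * (P%:Z - 1))%R.
Proof.
move=> P1 [ea eg ew]; set D := (P%:Z - 1)%R.
have [y ey [z ez]] := exp_expansion D s.
have DP : (1 + D = P%:Z)%R by rewrite /D; ring.
have D0 : (D != 0)%R by rewrite /D; lia.
have eaD : (a%:Z * D = P%:Z ^+ s - 1)%R.
  have <- : ((P ^ s)%N%:Z = P%:Z ^+ s)%R by rewrite -!natz GRing.natrX.
  by rewrite /D; lia.
have ea1 : (a%:Z = s%:Z + y * D)%R.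
  apply: (GRing.mulIf D0); rewrite eaD -DP ey; ring.
have ea2 : (2 * a%:Z = 2 * s%:Z + s%:Z * (s%:Z - 1) * D + z * D ^+ 2)%R.
  apply: (GRing.mulIf D0).
  transitivity (2 * (1 + D) ^+ s - 2)%R; last by rewrite ez; ring.
  transitivity (2 * (a%:Z * D))%R; first by ring.
  by rewrite eaD DP; ring.
have egD : (a%:Z = k%:Z + g%:Z * D)%R by rewrite /D; lia.
have ewD : (t%:Z = 2 * g%:Z + k%:Z - w%:Z * D)%R by rewrite /D; lia.
exists (g%:Z - y)%R.
have es : (s%:Z = k%:Z + (g%:Z - y) * D)%R.
  have -> : (s%:Z = a%:Z - y * D)%R by rewrite ea1; ring.
  by rewrite egD; ring.
have eg2 : (2 * g%:Z = 2 * (g%:Z - y) + s%:Z * (s%:Z - 1) + z * D)%R.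
  apply: (GRing.mulIf D0).
  have -> : (2 * g%:Z * D = 2 * a%:Z - 2 * k%:Z)%R by rewrite egD; ring.
  by rewrite ea2 {1}es; ring.
exists ((g%:Z - y) * (2 * k%:Z - 1 + (g%:Z - y) * D) + z - w%:Z)%R.
split=> //.
by rewrite ewD eg2 es; ring.
Qed.

Lemma square_cert_complete P k : exists a g w, square_cert P (P ^ k) k (k ^ 2) a g w.
Proof.
elim: k => [|k [a [g [w [ea eg ew]]]]]; first by exists 0, 0, 0.
(* Formally, with [D = P - 1], these are the recurrences of [(P ^ k - 1) / D], [(a - k) / D] and
   [(2 g + k - k ^ 2) / D]. *)
exists (a * P + 1), (g + a), (w + 2 * g); split.
- rewrite expnSr; have -> : P ^ k = a * P + 1 - a by lia.
  nia.
- nia.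
- nia.
Qed.

(** As [P ^ 2 - 1 = D (D + 2)], the unknown quotients satisfy [u = u' (D + 2)]. Twice the congruence
    for [P ^ 2] minus that for [P] cancels them modulo [D], and both [t] and [k ^ 2] are below
    [D]. *)
Lemma square_certs P s k t a g w a' g' w' : 1 < P -> k ^ 2 < P - 1 -> t < P - 1 ->
  square_cert P (P ^ s) k t a g w ->
  square_cert (P * P) (P ^ s * P ^ s) k t a' g' w' -> t = k ^ 2.
Proof.
move=> P1 ltk ltt /(square_cert_sound P1) [u [y [es et]]].
rewrite -expnMn => h; have P2 : 1 < P * P by nia.
have [u' [y' [es' et']]] := square_cert_sound P2 h.
set D := (P%:Z - 1)%R in es et.
have ePP : ((P * P)%N%:Z - 1 = D * (D + 2))%R by rewrite /D PoszM; ring.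
rewrite ePP in es' et'.
have D0 : (D != 0)%R by rewrite /D; lia.
have eu : (u = u' * (D + 2))%R.
  apply: (GRing.mulIf D0).
  have -> : (u * D = s%:Z - k%:Z)%R by rewrite es; ring.
  by rewrite es'; ring.
have key : (t%:Z - k%:Z * k%:Z = (2 * y' * (D + 2) - 2 * u' - y) * D)%R.
  have -> : (t%:Z - k%:Z * k%:Z = 2 * (t%:Z - k%:Z * k%:Z) - (t%:Z - k%:Z * k%:Z))%R.
    by ring.
  rewrite {1}et' et eu; ring.
set c := (2 * y' * (D + 2) - 2 * u' - y)%R in key.
rewrite -mulnn in ltk *.
suff c0 : c = 0%R by move: key; rewrite c0; lia.
move: key ltk ltt; rewrite /D; clearbody c.
move=> {et et' es es' eu ePP D0}; nia.
Qed.

(** * Multiplication *)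

Variant div_symbol := DivOne | DivAdd | DivDiv.

Definition div_interp (p : nat) (k : div_symbol) (x y z : nat) : Prop :=
  match k with
  | DivOne => x = 1
  | DivAdd => x + y = z
  | DivDiv => divp p x y
  end.

#[global] Instance div_additive p : additive (div_interp p).
Proof.
split; first exact: (definable_atom (div_interp p) DivAdd 0 1 2).
exact: (definable_atom (div_interp p) DivOne 0 0 0).
Qed.

Lemma definable_divp p t u : defterm (div_interp p) t -> defterm (div_interp p) u ->
  definable (div_interp p) (fun v => divp p (t v) (u v)).
Proof.
apply: (definable_app2 (R := divp p)).
exact: (definable_atom (div_interp p) DivDiv 0 1 0).
Qed.

Lemma divp_one p x : divp p 1 x <-> ppow p x.
Proof.
split=> [[s [->|h]]|[s ->]].
- by exists s; rewrite muln1.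
- by exists 0; move/esym/eqP: h; rewrite muln_eq1 => /andP[_ /eqP].
- by exists s; left; rewrite muln1.
Qed.

(** * Multiplication by a power of [p], squares and products *)

Section Shift.

Variable p : nat.
Hypothesis p_prime : prime p.

Let p1 : 1 < p. Proof. exact: prime_gt1. Qed.

(** The [p]-adic valuation reads off the outer exponent, since [p ^ i + 1] is prime to [p] for
    [i > 0]. *)
Lemma ppow_add1_inj s m n j : 0 < m -> 0 < j ->
  p ^ s * (p ^ m + 1) = p ^ n * (p ^ j + 1) -> s = n /\ m = j.
Proof.
move=> m0 j0 eq_sn.
have logE r i : 0 < i -> logn p (p ^ r * (p ^ i + 1)) = r.
  move=> i0; have pr0 : 0 < p ^ r by rewrite expn_gt0 prime_gt0.
  rewrite lognM //; last by rewrite addn1.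
  rewrite (pfactorK _ p_prime) logn_coprime ?addn0 // prime_coprime //.
  rewrite dvdn_addr; last by rewrite dvdn_exp.
  by rewrite dvdn1; apply/negP => /eqP; lia.
have sn : s = n by rewrite -(logE s m m0) eq_sn logE.
split=> //; move/eqP: eq_sn; rewrite sn eqn_pmul2l ?expn_gt0 ?prime_gt0 //.
by rewrite eqn_add2r eqn_exp2l // => /eqP.
Qed.

(** [z + x = x (z / x + 1)] differs from [y + 1] by a power of [p] only if [z / x = y]. *)
Lemma divp_ppow_mul x y z : ppow p x -> ppow p y -> ppow p z ->
  1 < y -> x < z -> divp p (z + x) (y + 1) <-> z = x * y.
Proof.
move=> [n ->] [m ->] [k ->] y1 xz; split.
- have m0 : 0 < m by case: m y1.
  have nk : n < k by rewrite -(ltn_exp2l _ _ p1).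
  have -> : p ^ k + p ^ n = p ^ n * (p ^ (k - n) + 1).
    by rewrite mulnDr muln1 -expnD subnKC // ltnW.
  have kn : 0 < k - n by lia.
  move=> [s [|]] h.
  + have [|sn0 ->] := @ppow_add1_inj 0 m (s + n) (k - n) m0 kn.
      by rewrite expn0 mul1n h expnD mulnA.
    rewrite -expnD; congr (_ ^ _); lia.
  + have [_ <-] := @ppow_add1_inj n (k - n) s m kn m0 h.
    by rewrite -expnD; congr (_ ^ _); lia.
- by move=> ->; exists n; right; rewrite mulnDr muln1.
Qed.

Definition shift (P a b : nat) : Prop := ppow p P /\ b = P * a.

(** [M] is a power of [p] above [a], and the previous lemma pins [z = P M]. The bounds [a < M] and
    [b < z] keep the ratio of [z + b] to [M + a] strictly between [P / 2] and [2 P]; being a power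
    of [p], it is [P]. *)
Lemma shiftE P a b : shift P a b <-> exists M z,
  (divp p 1 P /\ divp p 1 M /\ divp p 1 z) /\
  (1 < M /\ P < z /\ divp p (z + P) (M + 1)) /\
  (a < M /\ b < z /\ divp p (z + b) (M + a)).
Proof.
split=> [[hP ->]|].
  have P0 := ppow_gt0 (ltnW p1) hP.
  have [M hM ltM] := ppow_ge (a + 1) p1.
  have hz : ppow p (P * M).
    by have [[n ->] [m ->]] := (hP, hM); exists (n + m); rewrite expnD.
  have [ltPz M1 aM] : [/\ P < P * M, 1 < M & a < M] by split; nia.
  have ltb : P * a < P * M by rewrite ltn_pmul2l.
  exists M, (P * M); rewrite !divp_one; split; first by [].
  split; first by do 2!split=> //; apply/divp_ppow_mul.
  by do 2!split=> //; have [n ->] := hP; exists n; right; rewrite mulnDr.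
move=> [M [z [[hP [hM hz]] [[M1 [ltPz hPM]] [aM [bz hs]]]]]].
move: hP hM hz; rewrite !divp_one => hP hM hz.
move/(divp_ppow_mul hP hM hz M1 ltPz): hPM => defz.
rewrite {}defz in bz hs; split=> //.
have P0 := ppow_gt0 (ltnW p1) hP.
have [n defP] := hP.
have lt_exp i j : i < j -> 2 * p ^ i <= p ^ j.
  move=> ij; apply: leq_trans (leq_pexp2l (ltnW p1) ij).
  by rewrite expnS leq_mul.
have half s : P < 2 * p ^ s -> p ^ s < 2 * P -> p ^ s = P.
  rewrite defP; case: (ltngtP s n) => [/lt_exp|/lt_exp|-> //]; lia.
case: hs => s [h|h]; have : 0 < p ^ s by rewrite expn_gt0 prime_gt0.
- move: (p ^ s) h => x h x0.
  have : (x * P) * M < 2 * M by have := leq0n (x * b); lia.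
  rewrite ltn_pmul2r; last lia.
  move=> xP; have /eqP : x * P = 1 by have : 0 < x * P; rewrite ?muln_gt0 ?x0 //; lia.
  by rewrite muln_eq1 => /andP[/eqP x1 /eqP P1]; move: h; rewrite x1 P1; lia.
- move: (half s) h; move: (p ^ s) => x hx h x0.
  have ltM : x * a < x * M by rewrite ltn_pmul2l.
  have M0 : 0 < M by lia.
  have eqs : x = P.
    apply: hx; rewrite -(ltn_pmul2r M0); have := leq0n (x * a); lia.
  by move: h; rewrite eqs; lia.
Qed.

Lemma definable_shift t u r : defterm (div_interp p) t -> defterm (div_interp p) u ->
  defterm (div_interp p) r -> definable (div_interp p) (fun v => shift (t v) (u v) (r v)).
Proof.
apply: definable_app3.
apply: definable_ext => [v|]; first exact: shiftE.
by repeat (def_step || refine (definable_divp _ _)).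
Qed.

(** [P] is the square of a power of [p] above [k + 1], which ensures [k ^ 2 < P - 1] before squares
    are available. The two blocks are the certificates for [P] and for [P ^ 2]. *)
Definition square_rel (k t : nat) : Prop := exists P0 P Q P' Q' a g w a' g' w',
  (k.+1 < P0 /\ t.+1 < P /\ divp p 1 Q) /\
  (shift P0 P0 P /\ shift P P P' /\ shift Q Q Q') /\
  exists aP gP wP, (shift P a aP /\ shift P g gP /\ shift P w wP) /\
  (aP + 1 = Q + a /\ a + g = k + gP /\ g + g + k + w = t + wP) /\
  exists aP gP wP, (shift P' a' aP /\ shift P' g' gP /\ shift P' w' wP) /\
  (aP + 1 = Q' + a' /\ a' + g' = k + gP /\ g' + g' + k + w' = t + wP).

Lemma sqr_lt k m : k.+1 < m -> (k ^ 2).+1 < m * m.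
Proof. by move=> km; have := leq_mul km km; rewrite -mulnn; lia. Qed.

Lemma square_relE k t : t = k ^ 2 <-> square_rel k t.
Proof.
split=> [->|].
- have [P0 hP0 ltP0] := ppow_ge k.+1 p1.
  set P := P0 * P0.
  have [a [g [w [ea eg ew]]]] := square_cert_complete P k.
  have [a' [g' [w' [ea' eg' ew']]]] := square_cert_complete (P * P) k.
  have hP : ppow p P by rewrite /P mulnn; apply: ppow_exp.
  have hQ := ppow_exp k hP.
  have hP2 : ppow p (P * P) by rewrite mulnn; apply: ppow_exp.
  exists P0, P, (P ^ k), (P * P), (P ^ k * P ^ k), a, g, w, a', g', w'.
  split; first by rewrite divp_one; do !split=> //; apply: sqr_lt.
  split; first by [].
  exists (P * a), (P * g), (P * w); split; first by [].
  split; first by do !split; lia.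
  exists (P * P * a'), (P * P * g'), (P * P * w'); split; first by [].
  by rewrite -expnMn; do !split; lia.
- move=> [P0 [P [Q [P' [Q' [a [g [w [a' [g' [w' [[ltk [ltt]]]]]]]]]]]]]].
  rewrite divp_one => hQ [[[hP0 defP] [[hP ->] [_ ->]]]].
  move=> [_ [_ [_ [[[_ ->] [[_ ->] [_ ->]]] [[ea [eg ew]]]]]]].
  move=> [_ [_ [_ [[[_ ->] [[_ ->] [_ ->]]] [ea' [eg' ew']]]]]].
  have P1 : 1 < P by lia.
  have [s defQ] : exists s, Q = P ^ s by apply: (@ppow_eq_exp p P Q a) => //; lia.
  have hk : k ^ 2 < P - 1 by have := sqr_lt ltk; lia.
  have ht : t < P - 1 by lia.
  apply: (@square_certs P s k t a g w a' g' w') => //.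
  + by rewrite -defQ; split; lia.
  + by rewrite -defQ; split; lia.
Qed.

Lemma definable_square t u : defterm (div_interp p) t -> defterm (div_interp p) u ->
  definable (div_interp p) (fun v => square_rel (t v) (u v)).
Proof.
apply: definable_app2; rewrite /square_rel.
by repeat (def_step || refine (definable_divp _ _) || refine (definable_shift _ _ _)).
Qed.

Lemma definable_div_mul : definable (div_interp p) (fun v => v 0 * v 1 = v 2).
Proof.
apply: (@definable_ext _ _ (fun v => exists a b c, square_rel (v 0) a /\
  square_rel (v 1) b /\ square_rel (v 0 + v 1) c /\ c = a + b + v 2 + v 2)).
- move=> v; split=> [<-|[a [b [c]]]].
    exists (v 0 ^ 2), (v 1 ^ 2), ((v 0 + v 1) ^ 2).
    by rewrite -!square_relE; do !split; rewrite -!mulnn; lia.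
  by rewrite -!square_relE -!mulnn => -[-> [-> [-> h]]]; lia.
- by repeat (def_step || refine (definable_square _ _)).
Qed.

End Shift.

(** * Lucas sequences and exponentiation *)

Definition zdvd (d x : int) : Prop := exists z : int, x = (z * d)%R.

Section ZDivisibility.

Local Open Scope ring_scope.

Lemma zdvdD d x y : zdvd d x -> zdvd d y -> zdvd d (x + y).
Proof. by move=> [a ->] [b ->]; exists (a + b); ring. Qed.

Lemma zdvdB d x y : zdvd d x -> zdvd d y -> zdvd d (x - y).
Proof. by move=> [a ->] [b ->]; exists (a - b); ring. Qed.

Lemma zdvdMl d x y : zdvd d x -> zdvd d (y * x).
Proof. by move=> [a ->]; exists (y * a); ring. Qed.

Lemma zdvd_trans d x y : zdvd d x -> zdvd x y -> zdvd d y.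
Proof. by move=> [a ->] [b ->]; exists (b * a); ring. Qed.

Lemma zdvd_small (d x : int) : zdvd d x -> - d < x < d -> x = 0.
Proof.
move=> [a ->] h; have [->|[h1|h1]] : a = 0 \/ 1 <= a \/ a <= -1 by lia.
- by rewrite GRing.mul0r.
- by nia.
- by nia.
Qed.

End ZDivisibility.

(** Free of subtraction, hence positive existential. *)
Definition cong_mod (m x y : nat) : Prop := exists a b, x + a * m = y + b * m.

Lemma cong_modP m x y : cong_mod m x y <-> zdvd m (x%:Z - y%:Z)%R.
Proof.
split=> [[a [b h]]|[z h]].
  by exists (b%:Z - a%:Z)%R; lia.
case: z h => n h; first by exists 0, n; lia.
by exists n.+1, 0; move: h; rewrite NegzE; lia.
Qed.

Lemma cong_modn m x y : x = y %[mod m] -> cong_mod m x y.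
Proof.
move=> h; exists (y %/ m), (x %/ m).
by rewrite {1}(divn_eq x m) {2}(divn_eq y m) h; lia.
Qed.

(* [pell A l] is the pair of consecutive terms [(a_l, a_(l+1))] of the Lucas
   sequence [a_0 = 0], [a_1 = 1], [a_(l+2) = A a_(l+1) - a_l]. *)
Definition pell (A : int) (l : nat) : int * int :=
  iter l (fun c => (c.2, A * c.2 - c.1)%R) (0%R, 1%R).

(** For [A = 2] the sequence is [0, 1, 2, ...]. *)
Lemma pell_index (A y x : int) l : pell A l = (y, x) ->
  zdvd (A - 2)%R (y - l%:Z)%R /\ zdvd (A - 2)%R (x - l.+1%:Z)%R.
Proof.
elim: l y x => [|l IH] y x.
  by case=> <- <-; split; exists 0%R; lia.
rewrite /pell iterS -/(pell A l).
case E : (pell A l) => [y0 x0] [<- <-] /=.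
have [h1 h2] := IH _ _ E; split=> //.
have -> : (A * x0 - y0 - l.+2%:Z =
  (A * (x0 - l.+1%:Z) - (y0 - l%:Z)) + l.+1%:Z * (A - 2))%R.
  have -> : (l.+2%:Z = l%:Z + 2)%R by lia.
  have -> : (l.+1%:Z = l%:Z + 1)%R by lia.
  by ring.
apply: zdvdD; last by exists (Posz l.+1).
by apply: zdvdB => //; apply: zdvdMl.
Qed.

(** With [A = P + 1 / P] modulo [C], the quantity [P a_(l+1) - a_l] is multiplied by [P] at each
    step. *)
Lemma pell_exp (A C P y x : int) l : zdvd C (P * A - (P * P + 1))%R ->
  pell A l = (y, x) -> zdvd C (P * x - P * P ^+ l - y)%R.
Proof.
move=> hA; elim: l y x => [|l IH] y x.
  by case=> <- <-; exists 0%R; rewrite GRing.expr0; ring.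
rewrite /pell iterS -/(pell A l).
case E : (pell A l) => [y0 x0] [<- <-] /=.
have -> : (P * (A * x0 - y0) - P * P ^+ l.+1 - x0 =
  x0 * (P * A - (P * P + 1)) + P * (P * x0 - P * P ^+ l - y0))%R.
  by rewrite GRing.exprS; ring.
by apply: zdvdD; apply: zdvdMl => //; apply: IH.
Qed.

(** Descent by Vieta jumping: [(y, x)] comes from the smaller solution [(A y - x, y)]. *)
Lemma pell_sound (A x y : nat) : y <= x -> x * x + y * y = A * x * y + 1 ->
  exists l, pell A l = (Posz y, Posz x).
Proof.
elim/ltn_ind: y x => y IH x le_yx eq_xy.
have [y0|y_gt0] := posnP y.
  by exists 0; rewrite y0 in eq_xy *; congr (_, _); nia.
have x_gt0 : 0 < x by lia.
have yy0 : 0 < y * y by rewrite muln_gt0 y_gt0.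
have le_xA : x <= A * y by rewrite -(leq_pmul2l x_gt0); lia.
have defz : (A * y - x) + x = A * y by rewrite subnK.
move: (A * y - x) defz => z defz.
have eq_xz : x * z + 1 = y * y.
  have : x * (z + x) = x * (A * y) by rewrite defz.
  by lia.
have lt_zy : z < y.
  rewrite -(ltn_pmul2l x_gt0); apply: (@leq_trans (y * y)); first lia.
  by rewrite leq_mul2r le_yx orbT.
have eq_yz : y * y + z * z = A * y * z + 1.
  have : z * (z + x) = z * (A * y) by rewrite defz.
  by lia.
have [l hl] := IH z lt_zy y (ltnW lt_zy) eq_yz.
exists l.+1; rewrite /pell iterS -/(pell A l) hl /=; congr (_, _).
by lia.
Qed.

Lemma pell_complete (A : nat) l : 1 < A -> exists x y : nat,
  [/\ pell A l = (Posz y, Posz x), y < x & x * x + y * y = A * x * y + 1].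
Proof.
move=> A1; elim: l => [|l [x [y [hl lt_yx eq_xy]]]]; first
  by exists 1, 0; split; rewrite ?muln0 ?muln1.
have le_y : x + y < A * x.
  have : 2 * x <= A * x by rewrite leq_mul2r A1 orbT.
  by lia.
have defz : A * x - y + y = A * x by rewrite subnK //; lia.
move: (A * x - y) defz => z defz.
exists z, x; split; last 1 first.
- have : z * (z + y) = z * (A * x) by rewrite defz.
  have : y * (z + y) = y * (A * x) by rewrite defz.
  by lia.
- by rewrite /pell iterS -/(pell A l) hl /=; congr (_, _); lia.
- by lia.
Qed.

(* [P ^ m = -1] modulo [C], and [C] is too large for two distinct powers
   below [P ^ m] to agree up to sign. *)
Lemma exp_cong_order (C P : int) l s m : (3 < P)%R -> s < m ->
  zdvd C (P ^+ m + 1)%R -> (P ^+ m + 1 <= C + C)%R ->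
  zdvd C (P ^+ l - P ^+ s)%R -> zdvd m (l%:Z - s%:Z)%R.
Proof.
move=> P3 lt_sm hm leC hl.
have m0 : 0 < m by lia.
have P0 : (0 < P)%R by lia.
(* As [P ^ m = -1] modulo [C], removing [m] from the exponent flips the sign, so both signs are
   carried along. *)
have red q r e : zdvd C (P ^+ (q * m + r) - e)%R \/ zdvd C (P ^+ (q * m + r) + e)%R ->
  zdvd C (P ^+ r - e)%R \/ zdvd C (P ^+ r + e)%R.
  elim: q => [|q IH]; first by rewrite mul0n.
  move=> h; apply: IH; rewrite mulSn -addnA GRing.exprD in h.
  set x := (P ^+ (q * m + r))%R in h *.
  case: h => h; [right|left].
  - have -> : (x + e = x * (P ^+ m + 1) - (P ^+ m * x - e))%R by ring.
    by apply: zdvdB h; apply: zdvdMl.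
  - have -> : (x - e = x * (P ^+ m + 1) - (P ^+ m * x + e))%R by ring.
    by apply: zdvdB h; apply: zdvdMl.
have lt_rm : l %% m < m by rewrite ltn_mod.
have leP i : i < m -> (0 < P ^+ i)%R /\ (4 * P ^+ i <= P ^+ m)%R.
  move=> im; have Pi : (0 < P ^+ i)%R by rewrite Num.Theory.exprn_gt0.
  have : (P ^+ i.+1 <= P ^+ m)%R by rewrite Num.Theory.ler_weXn2l //; lia.
  by rewrite GRing.exprS; split=> //; nia.
have [Pr lePr] := leP _ lt_rm; have [Ps lePs] := leP _ lt_sm.
have : l %% m = s.
  have [] := red (l %/ m) (l %% m) (P ^+ s)%R; rewrite -?divn_eq; first by left.
  - move=> /zdvd_small h.
    have /h/GRing.subr0_eq : (- C < P ^+ (l %% m) - P ^+ s < C)%R by lia.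
    by apply: Num.Theory.ieexprIn => //; lia.
  - move=> /zdvd_small h.
    have /h : (- C < P ^+ (l %% m) + P ^+ s < C)%R by lia.
    by lia.
by move=> <-; exists (Posz (l %/ m)); rewrite {1}(divn_eq l m); lia.
Qed.

(* [y] is a term of index [l] of the Lucas sequence of parameter [A]; modulo [D],
   [l] equals [k] and also the exponent [s] of [Q = P ^ s], and [k, s < D]. *)
Definition pow_cert (p P k Q D R C A x y : nat) : Prop :=
  (ppow p P /\ ppow p Q /\ ppow p R) /\
  (3 < P /\ 1 < Q /\ 1 < R /\ D.+1 = Q /\ k < D) /\
  ((exists a, a * P + 1 = Q + a) /\ (exists r, R = r * D * D + 1)) /\
  ((exists c, c * C = R + 1) /\ R + 1 <= C + C) /\
  ((exists i, A = i * D + 2) /\ cong_mod C (P * A) (P * P + 1)) /\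
  (x * x + y * y = A * x * y + 1 /\ y <= x) /\
  (cong_mod D y k /\ cong_mod C (P * x) (P * Q + y)).

Lemma PoszX a n : (Posz (a ^ n) = (Posz a) ^+ n)%R.
Proof. by rewrite -!natz GRing.natrX. Qed.

(** [(1 + D) ^ j = 1 + j D] modulo [D ^ 2]. *)
Lemma exp_sqr_dvd D j r : 0 < D -> D.+1 ^ j = r * D * D + 1 -> zdvd D j.
Proof.
move=> D0 h; have [y ey _] := exp_expansion D%:Z j.
have e1 : (D.+1%:Z = 1 + D%:Z)%R by lia.
have := PoszX D.+1 j; rewrite h e1 ey => {}h.
exists (r%:Z - y)%R.
have Dn0 : (D%:Z != 0)%R by lia.
apply: (GRing.mulIf Dn0).
transitivity (1 + j%:Z * D%:Z + y * D%:Z ^+ 2 - 1 - y * D%:Z ^+ 2)%R; first by ring.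
by rewrite -h GRing.expr2; lia.
Qed.

(** Write [Q = P ^ s] and [R = P ^ m]; then [D] divides [m]. The congruences modulo [C] give [l = s]
    modulo [m], hence modulo [D], where also [l = y = k]; finally [k, s < D]. *)
Lemma pow_cert_sound p P k Q D R C A x y : 1 < p ->
  pow_cert p P k Q D R C A x y -> 0 < k /\ Q = P ^ k.
Proof.
move=> p1 [[hP [hQ hR]] [[P3 [Q1 [R1 [eD kD]]]] [[[a ea] [r er]]]]].
move=> [[[c ec] leC] [[[i ei] hA] [[exy le_yx] [hyk hx]]]].
have [s es] : exists s, Q = P ^ s by apply: (ppow_eq_exp p1 _ hP hQ ea); lia.
have [j ej] : exists j, R = Q ^ j.
  by apply: (ppow_eq_exp (a := r * D) p1 Q1 hQ hR); rewrite er -eD; lia.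
have D0 : 0 < D by lia.
have s0 : 0 < s by case: s es => // es; rewrite es in Q1.
have j0 : 0 < j by case: j ej => // ej; rewrite ej in R1.
have lt_sQ : s < D.
  have : s.+1 < P ^ s.
    elim: s s0 {es} => // -[|s] IH _; first by rewrite expn1; lia.
    have := IH isT; rewrite [P ^ s.+2]expnS.
    by move: (P ^ _) => X; nia.
  by rewrite -es; lia.
have hDj : zdvd D j by apply: (@exp_sqr_dvd D j r) => //; rewrite eD -ej.
set m := s * j.
have eRm : R = P ^ m by rewrite ej es -expnM.
have hDm : zdvd D m.
  by rewrite /m PoszM; apply: zdvdMl.
have lt_sm : s < m.
  have : 1 < j.
    have [z ez] := hDj; have : (0 < z)%R by nia.
    by nia.
  by rewrite /m; nia.
have [l hl] := pell_sound le_yx exy.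
have [hyl _] := pell_index hl.
have hDA : zdvd D (A%:Z - 2)%R by exists i%:Z%R; lia.
have eX : (Posz R = P%:Z ^+ m)%R by rewrite eRm PoszX.
have hCR : zdvd C (P%:Z ^+ m + 1)%R by exists c%:Z%R; rewrite -eX; lia.
have hC : zdvd C (P%:Z * (P%:Z ^+ l - P%:Z ^+ s))%R.
  have /cong_modP h1 := hx; have /cong_modP h2 := hA.
  have := pell_exp (P := P) (C := C) _ hl.
  have -> : (P%:Z * A%:Z - (P%:Z * P%:Z + 1) = (P * A)%N%:Z - (P * P + 1)%N%:Z)%R by lia.
  move=> /(_ h2) h3.
  have -> : (P%:Z * (P%:Z ^+ l - P%:Z ^+ s) = ((P * x)%N%:Z - (P * Q + y)%N%:Z)
     - (P%:Z * x%:Z - P%:Z * P%:Z ^+ l - y%:Z))%R.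
    by rewrite es !PoszD !PoszM PoszX; ring.
  exact: zdvdB.
(* [P] is invertible modulo [C], with inverse [- P ^ m.-1]. *)
have hC' : zdvd C (P%:Z ^+ l - P%:Z ^+ s)%R.
  have -> : (P%:Z ^+ l - P%:Z ^+ s = (P%:Z ^+ l - P%:Z ^+ s) * (P%:Z ^+ m + 1)
    - P%:Z ^+ m.-1 * (P%:Z * (P%:Z ^+ l - P%:Z ^+ s)))%R.
    have -> : m = m.-1.+1 by lia.
    by rewrite GRing.exprS /=; ring.
  by apply: zdvdB; apply: zdvdMl.
have hls : zdvd m (l%:Z - s%:Z)%R.
  by apply: (@exp_cong_order C P l s m _ lt_sm hCR _ hC'); rewrite -?eX; lia.
have /cong_modP hk := hyk.
have : zdvd D (k%:Z - s%:Z)%R.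
  have -> : (k%:Z - s%:Z = (y%:Z - l%:Z) - (y%:Z - k%:Z) + (l%:Z - s%:Z))%R by ring.
  apply: zdvdD (zdvd_trans hDm hls).
  by apply: zdvdB => //; apply: zdvd_trans hyl.
move/zdvd_small => h; have ks : k = s by have := h; lia.
by rewrite ks.
Qed.

Lemma pow_cert_complete p P k : 1 < p -> ppow p P -> 3 < P -> 0 < k ->
  exists D R C A x y, pow_cert p P k (P ^ k) D R C A x y.
Proof.
move=> p1 hP P3 k0; have [Q defQ] : exists Q, Q = P ^ k by exists (P ^ k).
rewrite -defQ; have ltkQ : k.+1 < Q.
  rewrite {}defQ; elim: k k0 => // -[|k] IH _; first by rewrite expn1; lia.
  have := IH isT; rewrite [P ^ k.+2]expnS.
  by move: (P ^ _) => X; nia.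
have [D eD] : exists D, D.+1 = Q by exists Q.-1; lia.
have D0 : 0 < D by lia.
have [R defR] : exists R, R = Q ^ D by exists (Q ^ D).
have R1 : 1 < R.
  apply: (@leq_trans Q); first lia.
  by rewrite defR -{1}[Q]expn1 leq_pexp2l //; lia.
(* In base [Q] with exponent [D], the certificate gives [R - 1 = a D] and [a = (g + 1) D]. *)
have [r er] : exists r, R = r * D * D + 1.
  have [a [g [w [ea eg _]]]] := square_cert_complete Q D.
  by exists (g + 1); move: ea eg; rewrite -defR -eD; nia.
have [m em] : exists m, k * D = m.+1.
  by exists (k * D).-1; rewrite prednK // muln_gt0 k0.
have eRm : R = P ^ m.+1 by rewrite -em expnM -defQ.
(* [C] is [R + 1], or half of it if [R] is odd. It is kept odd because a common divisor of [C] and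
   [D] divides both [R + 1] and [R - 1], hence [2]. *)
have [C [oddC [c ec] leC]] : exists C, [/\ odd C, exists c, c * C = R + 1 & R + 1 <= C + C].
  have [oddR|evR] := boolP (odd R); last first.
    exists (R + 1); split; [by rewrite addn1 | by exists 1; rewrite mul1n | lia].
  have /dvdnP [d ed] : 2 %| D.
    by move: oddR; rewrite defR -eD oddX dvdn2 /= => /orP[/eqP|//]; lia.
  exists (r * d * D + 1); split; last 1 first.
  - by rewrite er ed; lia.
  - by rewrite oddD oddM ed !oddM !andbF.
  - by exists 2; rewrite er ed; lia.
have copCD : coprime C D.
  rewrite /coprime; set g := gcdn C D.
  have gC : g %| C := dvdn_gcdl _ _; have gD : g %| D := dvdn_gcdr _ _.
  have : g %| r * D * D + 2.
    by apply/dvdnP; have /dvdnP [q eq] := gC; exists (c * q); lia.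
  rewrite dvdn_addr; last by rewrite dvdn_mull.
  move/(dvdn_leq (ltn0Sn 1)); case eg : g gC => [|[|[|//]]] // gC _.
    by move: gC; rewrite dvd0n => /eqP eC; rewrite eC in oddC.
  by move: oddC; rewrite -[odd C]negbK -dvdn2 gC.
have C0 : 0 < C by case: (C) oddC.
have CD0 : 0 < C * D by rewrite muln_gt0 C0.
(* [P ^ (m.+1 + m)] is the inverse of [P] modulo [C], since [P ^ m.+1 = R = -1] there. The added
   multiple of [C * D] makes [A > 1]. *)
have [A [A2 hAC hAD]] : exists A,
    [/\ 1 < A, A = P + P ^ (m.+1 + m) %[mod C] & A = 2 %[mod D]].
  exists (2 * (C * D) + chinese C D (P + P ^ (m.+1 + m)) 2); split.
  - by rewrite (leq_trans _ (leq_addr _ _)) // leq_pmulr.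
  - by rewrite mulnCA mulnC modnMDl chinese_modl.
  - by rewrite mulnA modnMDl chinese_modr.
have {hAD} [i ei] : exists i, A = i * D + 2.
  by clear hAC; move/eqP: hAD; rewrite eqn_mod_dvd // => /dvdnP[i hi]; exists i; lia.
have {hAC} hPA : cong_mod C (P * A) (P * P + 1).
  apply/cong_modP; move: hAC => /cong_modn/cong_modP h.
  have -> : ((P * A)%N%:Z - (P * P + 1)%N%:Z =
     P%:Z * (A%:Z - (P + P ^ (m.+1 + m))%N%:Z) + (R%:Z - 1) * (R%:Z + 1))%R.
    rewrite eRm !(PoszD, PoszM, PoszX) GRing.exprD !GRing.exprS.
    by ring.
  by apply: zdvdD; apply: zdvdMl => //; exists c%:Z%R; lia.
have [x [y [hl lt_yx exy]]] := pell_complete k A2.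
exists D, R, C, A, x, y.
split; first by split=> //; split; rewrite ?defR defQ; do 2?apply: ppow_exp.
split; first by do !split=> //; lia.
split; first (split; last by exists r).
  have [b [g [w [eb _ _]]]] := square_cert_complete P k.
  by exists b; rewrite defQ.
split; first by split=> //; exists c.
split; first by split=> //; exists i.
split; first by split=> //; exact: ltnW.
split; apply/cong_modP.
  have [+ _] := pell_index hl; apply: zdvd_trans.
  by exists i%:Z%R; lia.
have /cong_modP := hPA.
have -> : ((P * A)%N%:Z - (P * P + 1)%N%:Z = P%:Z * A%:Z - (P%:Z * P%:Z + 1))%R by lia.
move/pell_exp => /(_ _ _ _ hl).
by congr zdvd; rewrite defQ !PoszD !PoszM PoszX; ring.
Qed.

(** Abstracts the signature, as exponentiation is needed over both [div_interp] and [dom_interp]. *)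
Class ppow_ring (p : nat) K (I : K -> nat -> nat -> nat -> Prop) : Prop := PpowRing {
  ppow_ring_additive :: additive I;
  definable_var_mul : definable I (fun v => v 0 * v 1 = v 2);
  definable_var_ppow : definable I (fun v => ppow p (v 0))
}.

Lemma exp_add_lt x y m : x.+1 < m -> x ^ y + x < m ^ y.+1.
Proof.
move=> xm; elim: y => [|y IH]; first by rewrite expn0 expn1; lia.
case: x xm IH => [|x] xm IH; first by rewrite exp0n // addn0 expn_gt0; lia.
rewrite expnS [m ^ _]expnS.
apply: (@leq_ltn_trans (x.+1 * (x.+1 ^ y + x.+1))); first by nia.
by apply: ltn_mul => //; lia.
Qed.

Definition dig (B X k : nat) : nat := X %/ B ^ k %% B.

Lemma digP B X k d : 0 < B ->
  d = dig B X k <-> exists a c, X = (a * B + d) * B ^ k + c /\ d < B /\ c < B ^ k.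
Proof.
move=> B0; have Bk0 : 0 < B ^ k by rewrite expn_gt0 B0.
split=> [->|[a [c [-> [lt_d lt_c]]]]].
  exists (X %/ B ^ k %/ B), (X %% B ^ k).
  by rewrite /dig -!divn_eq !ltn_mod.
by rewrite /dig divnMDl // (divn_small lt_c) addn0 modnMDl modn_small.
Qed.

(** * Exponentiation and extraction of digits *)

Section PpowRing.

Variables (p : nat) (K : Type) (I : K -> nat -> nat -> nat -> Prop).
Context {prI : ppow_ring p I}.

Lemma term_mul t u : defterm I t -> defterm I u -> defterm I (fun v => t v * u v).
Proof.
apply: term_app2.
apply: (@definable_ext _ _ (fun v => v 1 * v 2 = v 0)) => [v|].
  by split=> ->.
exact: (definable_rename
  (fun j => if j is 0 then 1 else if j is 1 then 2 else 0) definable_var_mul).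
Qed.

Lemma definable_ppow t : defterm I t -> definable I (fun v => ppow p (t v)).
Proof. by apply: definable_app1; apply: definable_var_ppow. Qed.

#[local] Ltac def_hook ::= match goal with
  | |- defterm _ (fun v => muln _ _) => refine (term_mul _ _)
  | |- definable _ (fun v => ppow _ _) => refine (definable_ppow _)
  end.

Lemma term_sub t u : defterm I t -> defterm I u -> defterm I (fun v => t v - u v).
Proof.
apply: term_app2.
apply: (@definable_ext _ _ (fun v => exists w, v 0 + v 2 = v 1 + w /\ v 0 * w = 0)).
  move=> v; split=> [->|[w [h /eqP]]].
    exists (v 2 - v 1); split; first lia.
    by apply/eqP; rewrite muln_eq0 !subn_eq0; lia.
  by rewrite muln_eq0; lia.
by def_tac.
Qed.

Hypothesis p1 : 1 < p.

Definition pow_rel (P k Q : nat) : Prop :=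
  exists D R C A x y, pow_cert p P k Q D R C A x y.

Lemma pow_relE P k Q : pow_rel P k Q <-> [/\ ppow p P, 3 < P, 0 < k & Q = P ^ k].
Proof.
split=> [[D [R [C [A [x [y h]]]]]]|[hP P3 k0 ->]]; last exact: pow_cert_complete.
by have [k0 eQ] := pow_cert_sound p1 h; case: h => [[hP _] [[P3 _] _]].
Qed.

Lemma definable_pow t u r : defterm I t -> defterm I u -> defterm I r ->
  definable I (fun v => pow_rel (t v) (u v) (r v)).
Proof.
by apply: definable_app3; rewrite /pow_rel /pow_cert /cong_mod; def_tac.
Qed.

(** An arbitrary base [x] is reached through [x ^ y = P ^ y] modulo [P - x], for a power [P] of [p]
    with [x ^ y < P - x]. *)
Lemma term_exp t u : defterm I t -> defterm I u -> defterm I (fun v => t v ^ u v).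
Proof.
apply: term_app2.
(* [pow_rel] needs a positive exponent, so [Q = P ^ v 2] is obtained by dividing [Q' = P ^ (v 2).+1]
   by [P]. *)
apply: (@definable_ext _ _ (fun v => exists P0 P Q' Q d c,
  (pow_rel P0 (v 2).+1 P /\ pow_rel P (v 2).+1 Q') /\
  (v 1).+1 < P0 /\ Q * P = Q' /\ d + v 1 = P /\ v 0 < d /\ Q = c * d + v 0)).
  move=> v; split=> [->|].
    have [P0 hP0 ltP0] := ppow_ge (v 1 + 4) p1.
    have le_exp := exp_add_lt (v 2) (_ : (v 1).+1 < P0).
    set P := P0 ^ (v 2).+1 in le_exp.
    have {}le_exp : v 1 ^ v 2 + v 1 < P by apply: le_exp; lia.
    have PP0 : P0 <= P by rewrite -{1}[P0]expn1 leq_pexp2l //; lia.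
    have ed : (P - v 1) + v 1 = P by lia.
    move: (P - v 1) ed => d ed.
    exists P0, P, (P ^ (v 2).+1), (P ^ v 2), d, (P ^ v 2 %/ d).
    split.
      rewrite !pow_relE; split; split=> //; try lia.
      exact: ppow_exp.
    split; first lia.
    split; first by rewrite expnSr.
    have ltd : v 1 ^ v 2 < d by lia.
    do !split=> //; rewrite {1}(divn_eq (P ^ v 2) d); congr (_ + _).
    by rewrite -modnXm -{1}ed modnDl modnXm modn_small.
  move=> [P0 [P [Q' [Q [d [c [[]]]]]]]].
  rewrite !pow_relE => -[_ P03 _ eP] [_ P3 _ eQ'] [ltP0 [eQ [ed [lt_d eQd]]]].
  have ltx := exp_add_lt (v 2) ltP0; rewrite -eP in ltx.
  have eQ2 : Q = P ^ v 2.
    by apply/eqP; rewrite -(@eqn_pmul2r P) ?eQ ?eQ' ?expnSr //; lia.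
  have -> : v 0 = P ^ v 2 %% d by rewrite -eQ2 eQd modnMDl modn_small.
  by rewrite -ed -modnXm modnDl modnXm modn_small //; lia.
by repeat (def_step || refine (definable_pow _ _ _)).
Qed.

#[local] Ltac def_hook ::= match goal with
  | |- defterm _ (fun v => muln _ _) => refine (term_mul _ _)
  | |- defterm _ (fun v => expn _ _) => refine (term_exp _ _)
  | |- definable _ (fun v => ppow _ _) => refine (definable_ppow _)
  end.

Lemma term_digS t u r : defterm I t -> defterm I u -> defterm I r ->
  defterm I (fun v => dig (t v).+1 (u v) (r v)).
Proof.
apply: (@term_app3 _ _ _ (fun x => dig x.+1)).
by apply: definable_ext => [v|]; [exact: digP | def_tac].
Qed.

End PpowRing.

(** * Digits and digitwise order *)

Definition vec (B n : nat) (x : nat -> nat) : nat := \sum_(i < n) x i * B ^ i.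

Lemma vec0 B x : vec B 0 x = 0.
Proof. exact: big_ord0. Qed.

Lemma vecS B n x : vec B n.+1 x = vec B n x + x n * B ^ n.
Proof. exact: big_ord_recr. Qed.

Lemma eq_vec B n x y : (forall i, i < n -> x i = y i) -> vec B n x = vec B n y.
Proof. by move=> xy; apply: eq_bigr => i _; rewrite xy. Qed.

Lemma vecD B n x y : vec B n x + vec B n y = vec B n (fun i => x i + y i).
Proof.
elim: n => [|n IH]; first by rewrite !vec0.
by rewrite !vecS -IH mulnDl; lia.
Qed.

Lemma vecM B n c x : c * vec B n x = vec B n (fun i => c * x i).
Proof.
elim: n => [|n IH]; first by rewrite !vec0 muln0.
by rewrite !vecS -IH mulnDr mulnA.
Qed.

Lemma vec_lt B n x : 0 < B -> (forall i, i < n -> x i < B) -> vec B n x < B ^ n.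
Proof.
move=> B0; elim: n => [|n IH] xB; first by rewrite vec0.
rewrite vecS expnS.
have lt1 : vec B n x < B ^ n by apply: IH => i lt_in; apply: xB; apply: ltnW.
have : x n * B ^ n <= B.-1 * B ^ n by rewrite leq_mul2r; have := xB n; lia.
by case: B B0 {IH xB} lt1 => //= B _; lia.
Qed.

Lemma vec_widen B n m x : n <= m -> (forall i, n <= i -> x i = 0) ->
  vec B n x = vec B m x.
Proof.
move=> le_nm x0; rewrite -(subnKC le_nm); elim: (m - n) => [|d IH].
  by rewrite addn0.
by rewrite addnS vecS -IH x0 ?mul0n ?addn0 // leq_addr.
Qed.

Lemma dig_lt B X k : 0 < B -> dig B X k < B.
Proof. by move=> B0; rewrite ltn_mod. Qed.

Lemma vec_dig B n X : X < B ^ n -> vec B n (dig B X) = X.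
Proof.
elim: n X => [|n IH] X ltX; first by rewrite vec0; move: ltX; rewrite expn0; lia.
have B0 : 0 < B by case: B ltX {IH} => //; rewrite exp0n.
have Bn0 : 0 < B ^ n by rewrite expn_gt0 B0.
rewrite vecS {2}/dig modn_small; last by rewrite ltn_divLR // -expnS.
rewrite [RHS](divn_eq X (B ^ n)) [RHS]addnC; congr (_ + _).
rewrite -[RHS](IH (X %% B ^ n)) ?ltn_mod //; apply: eq_vec => i lt_in.
rewrite /dig {1}(divn_eq X (B ^ n)).
have -> : B ^ n = B ^ (n - i).-1 * B * B ^ i.
  by rewrite -expnSr -expnD; congr (_ ^ _); lia.
by rewrite mulnA divnMDl ?expn_gt0 ?B0 // mulnA modnMDl.
Qed.

Lemma dig_vec B n x k : 0 < B -> (forall i, i < n -> x i < B) -> k < n ->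
  dig B (vec B n x) k = x k.
Proof.
move=> B0 xB kn; apply/esym/digP => //.
exists (vec B (n - k.+1) (fun i => x (k.+1 + i))), (vec B k x).
split; last by split; [exact: xB | apply: vec_lt => // i ik; apply: xB; lia].
move: kn {xB}; elim: n => // n IH; rewrite ltnS leq_eqVlt => /orP[/eqP ->|kn].
  by rewrite subnn vec0 vecS; lia.
rewrite vecS IH // subSn // vecS subnKC //.
have -> : B ^ n = B ^ (n - k.+1) * B * B ^ k.
  by rewrite -expnSr -expnD; congr (_ ^ _); lia.
by lia.
Qed.

Lemma vec_inj B n x y : 0 < B -> (forall i, i < n -> x i < B) ->
  (forall i, i < n -> y i < B) -> vec B n x = vec B n y ->
  forall i, i < n -> x i = y i.
Proof.
by move=> B0 xB yB xy i lt_in; rewrite -(dig_vec B0 xB lt_in) xy dig_vec.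
Qed.

Lemma bin_le_exp n k : 'C(n, k) <= 2 ^ n.
Proof.
elim: n k => [|n IH] [|k] //; first by rewrite bin0 expn_gt0.
by rewrite binS expnS; have := IH k; have := IH k.+1; lia.
Qed.

(** By the binomial theorem [(u + 1) ^ n] has coefficients ['C(n, i)] in base [u], and [u > 2 ^ n]
    makes them digits. *)
Lemma bin_dig n k : 'C(n, k) = dig (2 ^ n).+1 ((2 ^ n).+2 ^ n) k.
Proof.
set u := (2 ^ n).+1.
(* The vector is padded up to index [k], so that [k > n] is covered with digit [0]. *)
have -> : u.+1 ^ n = vec u (maxn n k).+1 (fun i => 'C(n, i)).
  rewrite -(add1n u) expnDn; transitivity (vec u n.+1 (fun i => 'C(n, i))).
    by apply: eq_bigr => i _; rewrite exp1n mul1n.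
  by apply: vec_widen => [|i lt_ni]; rewrite ?ltnS ?leq_maxl ?bin_small.
by rewrite dig_vec // => [i _|]; [rewrite ltnS bin_le_exp | lia].
Qed.

Definition dom (p a b : nat) : Prop := forall k, dig p a k <= dig p b k.

Lemma modn_expS p a i : 0 < p -> a %% p ^ i.+1 = dig p a i * p ^ i + a %% p ^ i.
Proof.
move=> p0; have pi0 : 0 < p ^ i by rewrite expn_gt0 p0.
rewrite {1}(divn_eq a (p ^ i)) {1}(divn_eq (a %/ p ^ i) p) mulnDl -mulnA -expnS.
rewrite -addnA modnMDl modn_small // expnS -/(dig p a i).
have := dig_lt a i p0; have : a %% p ^ i < p ^ i by rewrite ltn_mod.
by move: (dig _ _ _) (p ^ i) (a %% _) => d q r h1 h2; nia.
Qed.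

Lemma dom_modP p a b : 0 < p -> dom p a b <-> forall i, a %% p ^ i <= b %% p ^ i.
Proof.
move=> p0; split=> [h i|h k].
  elim: i => [|i IH]; first by rewrite !modn1.
  by rewrite !modn_expS // leq_add // leq_mul2r h orbT.
have := h k.+1; rewrite !modn_expS //.
have pk0 : 0 < p ^ k by rewrite expn_gt0 p0.
have : b %% p ^ k < p ^ k by rewrite ltn_mod.
by move: (dig _ a _) (dig _ b _) (p ^ k) (a %% _) (b %% _) => d e q r s; nia.
Qed.

Lemma dom_le p a b : 1 < p -> dom p a b -> a <= b.
Proof.
move=> p1 /(dom_modP _ _ (ltnW p1))/(_ (a + b)).
have lt_ab := ltn_expl (a + b) p1.
by rewrite !modn_small //; lia.
Qed.

Lemma logn_fact_widen p n N : prime p -> n <= N ->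
  logn p n`! = \sum_(1 <= k < N.+1) n %/ p ^ k.
Proof.
move=> pp nN; rewrite logn_fact // [RHS](@big_cat_nat _ _ _ n.+1) //=.
rewrite [X in _ = _ + X]big_nat_cond [X in _ = _ + X]big1 ?addn0 // => i.
rewrite andbT => /andP[lt_ni _]; apply: divn_small.
by apply: ltn_trans lt_ni _; apply: ltn_expl; apply: prime_gt1.
Qed.

(* Kummer: the [p]-adic valuation of a binomial coefficient counts carries. *)
Lemma dom_bin p a b : prime p -> dom p a b <-> ~~ (p %| 'C(b, a)).
Proof.
move=> pp; have p1 := prime_gt1 pp; have p0 := ltnW p1.
have [lt_ba|le_ab] := ltnP b a.
  rewrite bin_small // dvdn0; split=> // /(dom_le p1); lia.
(* The inequality of remainders means that adding [a] and [b - a] modulo [d] produces no carry. *)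
have carry d : 0 < d -> (a %% d <= b %% d) = (b %/ d == a %/ d + (b - a) %/ d).
  move=> d0; rewrite -{1 2}(subnKC le_ab) modnD // divnD //.
  have := ltn_pmod a d0; have := ltn_pmod (b - a) d0.
  by case: leqP => /=; lia.
have logE : \sum_(1 <= k < b.+1) b %/ p ^ k = logn p 'C(b, a) +
    \sum_(1 <= k < b.+1) (a %/ p ^ k + (b - a) %/ p ^ k).
  rewrite big_split /= -!logn_fact_widen ?leq_subr //.
  rewrite -lognM ?fact_gt0 // -lognM ?bin_gt0 ?muln_gt0 ?fact_gt0 //.
  by rewrite bin_fact.
have le_term k : a %/ p ^ k + (b - a) %/ p ^ k <= b %/ p ^ k.
  have pk0 : 0 < p ^ k by rewrite expn_gt0 p0.
  by rewrite -{2}(subnKC le_ab) divnD // leq_addr.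
have -> : ~~ (p %| 'C(b, a)) = (logn p 'C(b, a) == 0).
  by rewrite -leqn0 leqNgt logn_gt0 mem_primes pp bin_gt0 le_ab.
rewrite dom_modP //; split=> [h|].
  rewrite -(eqn_add2r (\sum_(1 <= k < b.+1) (a %/ p ^ k + (b - a) %/ p ^ k))).
  rewrite -logE add0n; apply/eqP/eq_bigr => k _.
  by apply/eqP; rewrite -carry ?expn_gt0 ?p0.
move=> /eqP log0 i; rewrite carry ?expn_gt0 ?p0 //.
have [lt_bi|le_ib] := ltnP b i.
  have lt_bp : b < p ^ i by apply: ltn_trans lt_bi (ltn_expl _ p1).
  by rewrite !divn_small //; lia.
case: i le_ib => [|i] le_ib; first by rewrite expn0 !divn1; lia.
have in_i : i.+1 \in index_iota 1 b.+1 by rewrite mem_index_iota.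
(* The sums are equal and compare termwise, so the terms at [i.+1] agree. *)
move: logE; rewrite log0 add0n !(bigD1_seq _ in_i) ?iota_uniq //= => logE.
rewrite eqn_leq le_term andbT -(leq_add2r
  (\sum_(k <- index_iota 1 b.+1 | k != i.+1) b %/ p ^ k)) logE leq_add2l.
by apply: leq_sum => k _; apply: le_term.
Qed.

Section DefinableDom.

Variables (p : nat) (K : Type) (I : K -> nat -> nat -> nat -> Prop).
Context {prI : ppow_ring p I}.
Hypothesis p_prime : prime p.

Lemma term_bin t u : defterm I t -> defterm I u -> defterm I (fun v => 'C(t v, u v)).
Proof.
have p1 := prime_gt1 p_prime.
apply: term_app2; apply: (@definable_ext _ _ (fun v =>
  v 0 = dig (2 ^ v 1).+1 ((2 ^ v 1).+2 ^ v 1) (v 2))) => [v|].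
  by rewrite bin_dig.
by repeat (def_step || refine (term_digS p1 _ _ _) || refine (term_exp p1 _ _)).
Qed.

Lemma definable_dom t u : defterm I t -> defterm I u ->
  definable I (fun v => dom p (t v) (u v)).
Proof.
have p1 := prime_gt1 p_prime.
apply: definable_app2.
(* Non-divisibility is made positive by exhibiting the nonzero remainder [r.+1]. *)
apply: (@definable_ext _ _ (fun v => exists q r,
  'C(v 1, v 0) = q * p + r.+1 /\ r.+1 < p)) => [v|].
  rewrite dom_bin // /dvdn -lt0n; split=> [h|[q [r [-> lt_r]]]].
    exists ('C(v 1, v 0) %/ p), ('C(v 1, v 0) %% p).-1.
    by rewrite prednK // -divn_eq ltn_mod prime_gt0.
  by rewrite modnMDl modn_small.
by repeat (def_step || refine (term_bin _ _) || refine (term_mul _ _)).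
Qed.

End DefinableDom.

(** * Changes of base and domination of vectors *)

Lemma vec_cat B m n x :
  vec B (m + n) x = vec B m x + vec B n (fun i => x (m + i)) * B ^ m.
Proof.
elim: n => [|n IH]; first by rewrite addn0 vec0 mul0n addn0.
by rewrite addnS !vecS IH expnD; lia.
Qed.

(** A two-dimensional array with [f i j] at position [i + N j]; each [j] yields one coefficient in
    base [B ^ N]. *)
Lemma vec_flatten B N M (f : nat -> nat -> nat) :
  vec B (N * M) (fun k => f (k %% N) (k %/ N)) =
  vec (B ^ N) M (fun j => vec B N (fun i => f i j)).
Proof.
elim: M => [|M IH]; first by rewrite muln0 !vec0.
rewrite mulnS addnC vec_cat IH vecS -expnM; congr (_ + _ * _).
apply: eq_vec => i lt_iN; have N0 : 0 < N by lia.
by rewrite mulnC modnMDl divnMDl // modn_small // divn_small // addn0.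
Qed.

Lemma vec_delta B N j c : j < N ->
  vec B N (fun i => if i == j then c else 0) = c * B ^ j.
Proof.
move=> lt_jN; rewrite /vec (bigD1 (Ordinal lt_jN)) //= eqxx big1 ?addn0 // => i.
by rewrite -val_eqE /= => /negbTE ->.
Qed.

(** Evaluations at [E] and at [B] agree modulo [E - B], so a change of base becomes a congruence. *)
Lemma vec_rebase B E n x : B <= E ->
  exists c, vec E n x = vec B n x + c * (E - B).
Proof.
move=> BE; have expE i : exists c, E ^ i = B ^ i + c * (E - B).
  elim: i => [|i [c ec]]; first by exists 0.
  exists (B ^ i + c * E); rewrite !expnS ec.
  have := subnKC BE; move: (E - B) => d; move: (B ^ i) => q <-; lia.
elim: n => [|n [c ec]]; first by exists 0; rewrite !vec0.
have [d ed] := expE n; exists (c + x n * d).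
by rewrite !vecS ec ed; lia.
Qed.

Definition geo (B n : nat) : nat := vec B n (fun=> 1).

Lemma geoP B n y : 1 < B -> y = geo B n <-> y * B + 1 = B ^ n + y.
Proof.
move=> B1; have geoE : geo B n * B + 1 = B ^ n + geo B n.
  rewrite /geo; elim: n => [|n IH]; first by rewrite vec0.
  by rewrite vecS expnS; lia.
by split=> [-> //|]; move: (geo _ _) geoE => g; nia.
Qed.

Section Dom.

Variable p : nat.
Hypothesis p1 : 1 < p.

Let p0 : 0 < p. Proof. exact: ltnW. Qed.

Lemma dig_small a L k : a < p ^ L -> L <= k -> dig p a k = 0.
Proof.
move=> lt_a le_Lk; rewrite /dig divn_small ?mod0n //.
by apply: leq_trans lt_a _; rewrite leq_pexp2l.
Qed.

Lemma dig_split a c L k : a < p ^ L ->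
  dig p (a + c * p ^ L) k = if k < L then dig p a k else dig p c (k - L).
Proof.
move=> lt_a; case: ltnP => [lt_kL|le_Lk].
  have -> : p ^ L = p ^ (L - k).-1 * p * p ^ k.
    by rewrite -expnSr -expnD; congr (_ ^ _); lia.
  by rewrite /dig addnC mulnA divnMDl ?expn_gt0 ?p0 // mulnA modnMDl.
rewrite /dig -{1}(subnKC le_Lk) expnD divnMA addnC divnMDl ?expn_gt0 ?p0 //.
by rewrite (divn_small lt_a) addn0.
Qed.

Lemma dom_split a b c d L : a < p ^ L -> b < p ^ L ->
  dom p (a + c * p ^ L) (b + d * p ^ L) <-> dom p a b /\ dom p c d.
Proof.
move=> lt_a lt_b; split=> [h|[hab hcd] k]; last first.
  by rewrite !dig_split //; case: ifP.
split=> k; last first.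
  by have := h (k + L); rewrite !dig_split // ltnNge leq_addl /= addnK.
have [lt_kL|le_Lk] := ltnP k L; last by rewrite (dig_small lt_a).
by have := h k; rewrite !dig_split // lt_kL.
Qed.

Lemma dom0 a : dom p a 0 -> a = 0.
Proof. by move/(dom_le p1); lia. Qed.

(** [p ^ l - 1] consists of [l] digits [p - 1]. *)
Lemma dom_pred a l : dom p a (p ^ l - 1) <-> a < p ^ l.
Proof.
have pl0 : 0 < p ^ l by rewrite expn_gt0 p0.
split=> [/(dom_le p1)|lt_a]; first lia.
apply/dom_modP => // i.
have pi0 : 0 < p ^ i by rewrite expn_gt0 p0.
have [le_il|lt_li] := leqP i l; last first.
  rewrite [X in _ <= X]modn_small.
    by apply: leq_trans (leq_mod _ _) _; lia.
  by apply: leq_trans (_ : p ^ l <= p ^ i); rewrite ?leq_pexp2l //; lia.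
have -> : p ^ l - 1 = (p ^ (l - i) - 1) * p ^ i + (p ^ i - 1).
  have := subnK le_il => {1}<-; rewrite expnD mulnBl mul1n.
  have : 0 < p ^ (l - i) by rewrite expn_gt0 p0.
  by move: (p ^ (l - i)) (p ^ i) pi0 => c d; nia.
rewrite modnMDl [X in _ <= X]modn_small; last lia.
by have := ltn_pmod a pi0; lia.
Qed.

Lemma dom_vec L n x y :
  (forall i, i < n -> x i < p ^ L) -> (forall i, i < n -> y i < p ^ L) ->
  dom p (vec (p ^ L) n x) (vec (p ^ L) n y) <-> forall i, i < n -> dom p (x i) (y i).
Proof.
have B0 : 0 < p ^ L by rewrite expn_gt0 p0.
elim: n => [|n IH] xB yB; first by rewrite !vec0; split=> // _ k.
have xB' i : i < n -> x i < p ^ L by move=> ?; apply: xB; lia.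
have yB' i : i < n -> y i < p ^ L by move=> ?; apply: yB; lia.
rewrite !vecS -expnM dom_split ?expnM ?vec_lt // IH //.
split=> [[h hn] i|h]; last by split=> [i ?|]; apply: h; lia.
by rewrite ltnS leq_eqVlt => /orP[/eqP -> //|]; apply: h.
Qed.

Lemma dom_vec_inv L n X y : (forall i, i < n -> y i < p ^ L) ->
  dom p X (vec (p ^ L) n y) ->
  X = vec (p ^ L) n (dig (p ^ L) X) /\ forall i, i < n -> dom p (dig (p ^ L) X i) (y i).
Proof.
have B0 : 0 < p ^ L by rewrite expn_gt0 p0.
move=> yB h; have eX : X = vec (p ^ L) n (dig (p ^ L) X).
  by rewrite vec_dig // (leq_ltn_trans (dom_le p1 h)) // vec_lt.
split=> //; move: h; rewrite {1}eX dom_vec // => i _.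
exact: dig_lt.
Qed.

(** [p * v + 1] is [v] shifted by one place with a last digit [1] appended. Domination makes each
    digit of [v] at most the preceding one, starting at most at [1], so [v] is a repunit. *)
Lemma ppow_domE w : ppow p w <-> exists v, dom p v (p * v + 1) /\ w = (p - 1) * v + 1.
Proof.
have dom_cons a b c d : c < p -> d < p ->
  dom p (p * a + c) (p * b + d) <-> c <= d /\ dom p a b.
  move=> cp dp; have := @dom_split c d a b 1; rewrite expn1 => /(_ cp dp).
  rewrite addnC mulnC [d + _]addnC [b * p]mulnC => ->; split=> -[h ?]; split=> //.
    by apply: dom_le h.
  case=> [|k]; first by rewrite /dig expn0 !divn1 !modn_small.
  by rewrite !(@dig_small _ 1) ?expn1.
have eq_div u : u = p * (u %/ p) + u %% p by rewrite mulnC -divn_eq.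
have lt_mod u : u %% p < p by rewrite ltn_mod.
split=> [[s ->]|[v [hv ->]]].
  elim: s => [|s [v [hv ev]]].
    by exists 0; rewrite !muln0; split=> // k; rewrite /dig div0n mod0n.
  exists (p * v + 1); split; first by apply/dom_cons.
  by rewrite expnS ev; move: p1; case: (p) => // q _; rewrite subn1 /=; lia.
have no_shift u : dom p u (p * u) -> u = 0.
  elim/ltn_ind: u => u IH h; have [//|u0] := posnP u.
  move: h; rewrite -[p * u]addn0 {1}(eq_div u) dom_cons // leqn0 => -[/eqP d0 h].
  have eu : u = p * (u %/ p) by rewrite {1}(eq_div u) d0 addn0.
  by have := IH (u %/ p) (ltn_Pdiv p1 u0); rewrite -eu => /(_ h); lia.
elim/ltn_ind: v hv => v IH h; have [->|v0] := posnP v.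
  by exists 0; rewrite muln0.
move: h; rewrite {1}(eq_div v) dom_cons // => -[d1 h].
have [d0|d0] : v %% p = 0 \/ v %% p = 1 by lia.
  have eu : v = p * (v %/ p) by rewrite {1}(eq_div v) d0 addn0.
  by have := no_shift (v %/ p); rewrite -eu => /(_ h); lia.
have eu : v = p * (v %/ p) + 1 by rewrite {1}(eq_div v) d0.
have := IH (v %/ p) (ltn_Pdiv p1 v0); rewrite -eu => /(_ h) [s es].
exists s.+1; rewrite expnS -es {1}eu.
by move: p1 (v %/ p); case: (p) => // q _ u; rewrite subn1 /=; lia.
Qed.

End Dom.

(** * Vectors of digits and bounded quantifiers *)

(** The bound has [n] coefficients [b - 1] in base [E]. For powers of [p] with [b <= E], this says
    that [X] has [n] digits in base [E], all below [b]. *)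
Definition is_vec (p b E n X : nat) : Prop := dom p X ((b - 1) * geo E n).

(* Vanishes on the positions [i + (n + 1) i], and has digit [b ^ 2 - 1] in base
   [b ^ 2] on the other positions [i + (n + 1) j]. *)
Definition mask (b n : nat) : nat := let B := b * b in
  (B - 1) * (geo B n.+1 * geo (B ^ n.+1) n - geo (B ^ n.+2) n).

(* [Y'] and [Z'] are the vectors [Y] and [Z] rewritten in the sparser bases
   [B ^ (n + 1)] and [B ^ (n + 2)]; the products [x_i * y_j] are then the digits
   of [X * Y'], those with [i = j] sitting at the digits of [Z']. *)
Definition hadamard (p b n X Y Z : nat) : Prop := let B := b * b in
  exists Y' Z' O c d,
  (is_vec p b (B ^ n.+1) n Y' /\ Y' = Y + c * (B ^ n.+1 - B)) /\
  (is_vec p b (B ^ n.+2) n Z' /\ Z' = Z + d * (B ^ n.+2 - B)) /\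
  X * Y' = Z' + O /\ dom p O (mask b n).

Section Hadamard.

Variables (p l : nat).
Hypotheses (p1 : 1 < p) (l0 : 0 < l).

Let b := p ^ l.
Let B := b * b.

Lemma digit_bound_gt1 : 1 < b.
Proof. by rewrite /b -(expn0 p) ltn_exp2l. Qed.

Let b1 := digit_bound_gt1.
Let B1 : 1 < B. Proof. by rewrite /B; nia. Qed.
Let B0 : 0 < B. Proof. exact: ltnW. Qed.
Let bB : b < B. Proof. by rewrite /B; nia. Qed.
Let BE : B = p ^ (l + l). Proof. by rewrite expnD. Qed.

Lemma is_vecP L n X : l <= L -> is_vec p b (p ^ L) n X <->
  exists2 x, forall i, i < n -> x i < b & X = vec (p ^ L) n x.
Proof.
move=> lL; have le_bE : b <= p ^ L by rewrite leq_pexp2l // ltnW.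
rewrite /is_vec /geo vecM muln1.
have cE i : i < n -> b - 1 < p ^ L by lia.
split=> [/(dom_vec_inv p1 cE) [eX h]|[x xb ->]].
  by exists (dig (p ^ L) X) => // i /h /dom_pred; apply.
apply/dom_vec => // [i /xb|i /xb]; first lia.
by move=> h; apply/dom_pred.
Qed.

(** Read back in base [B], both vectors lie below [p ^ L - B], so their congruence modulo
    [p ^ L - B] is an equality. *)
Lemma rebaseP L n y Y' : l + l <= L -> (0 < n -> B ^ n + B <= p ^ L) ->
  (forall i, i < n -> y i < b) ->
  (is_vec p b (p ^ L) n Y' /\ exists c, Y' = vec B n y + c * (p ^ L - B))
  <-> Y' = vec (p ^ L) n y.
Proof.
move=> lL hL yb; have BL : B <= p ^ L by rewrite BE leq_pexp2l // ltnW.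
have lL' : l <= L by lia.
split=> [[/(is_vecP _ _ lL') [y' y'b ->]]|->]; last first.
  by split; [apply/is_vecP => //; exists y | apply: vec_rebase].
have [d ed] := vec_rebase n y' BL => -[c]; have [->|n0] := posnP n.
  by rewrite !vec0.
move=> eqY; rewrite {}ed in eqY.
have ltY x : (forall i, i < n -> x i < b) -> vec B n x < p ^ L - B.
  move=> xb; have : vec B n x < B ^ n by apply: vec_lt => // i /xb; lia.
  by have := hL n0; lia.
have eqv : vec B n y' = vec B n y.
  have := ltY _ y'b; have := ltY _ yb; have : vec B n y' = vec B n y %[mod p ^ L - B].
    by have := congr1 (modn^~ (p ^ L - B)) eqY; rewrite addnC modnMDl [in RHS]addnC modnMDl.
  by move=> h h1 h2; rewrite !modn_small in h.
have y'B i : i < n -> y' i < B by move/y'b; lia.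
have yB i : i < n -> y i < B by move/yb; lia.
by apply: eq_vec => i lt_in; apply: (vec_inj B0 y'B yB eqv).
Qed.

(** Coefficient [i] in base [B ^ n.+2] sits at position [(n + 2) i = i + (n + 1) i], on the diagonal
    of the array. *)
Lemma diag_vec n (z : nat -> nat) : vec (B ^ n.+2) n z =
  vec B (n.+1 * n) (fun k => if k %% n.+1 == k %/ n.+1 then z (k %/ n.+1) else 0).
Proof.
rewrite (vec_flatten B n.+1 n (fun i j => if i == j then z j else 0)).
apply: eq_bigr => i _; rewrite vec_delta; last by have := ltn_ord i; lia.
by rewrite -mulnA -!expnM -expnD; congr (_ * _ ^ _); lia.
Qed.

Lemma maskE n : mask b n =
  vec B (n.+1 * n) (fun k => if k %% n.+1 == k %/ n.+1 then 0 else B - 1).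
Proof.
rewrite /mask -/B mulnBr [(B - 1) * geo (B ^ n.+2) n]vecM diag_vec.
have -> : (B - 1) * (geo B n.+1 * geo (B ^ n.+1) n) =
    vec B (n.+1 * n) (fun=> B - 1).
  rewrite (vec_flatten B n.+1 n (fun _ _ => B - 1)) /geo !vecM.
  by apply: eq_vec => j _; rewrite !muln1 vecM; apply: eq_vec => i _; rewrite muln1.
apply/eqP; rewrite -(eqn_add2r (vec B (n.+1 * n) (fun k : nat =>
  if k %% n.+1 == k %/ n.+1 then (B - 1) * 1 else 0))) subnK.
  rewrite vecD; apply/eqP; apply: eq_vec => k _.
  by case: ifP => _; rewrite ?muln1 ?addn0.
by apply: leq_sum => k _; rewrite leq_mul2r; case: ifP; lia.
Qed.

(** Products [x i * y j] stay below [b ^ 2 = B], so [X * Y'] has no carries. [O] absorbs everything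
    off the diagonal and, by [mask], nothing on it. *)
Lemma hadamardP n x y z : (forall i, i < n -> x i < b) ->
  (forall i, i < n -> y i < b) -> (forall i, i < n -> z i < b) ->
  hadamard p b n (vec B n x) (vec B n y) (vec B n z) <->
  forall i, i < n -> x i * y i = z i.
Proof.
move=> xb yb zb; set N := n.+1.
have BN k : B ^ k = p ^ ((l + l) * k) by rewrite BE expnM.
have leN k : 0 < n -> n < k -> B ^ n + B <= B ^ k.
  move=> n0 nk; apply: (@leq_trans (B ^ n.+1)); last by rewrite leq_pexp2l.
  have : B ^ 1 <= B ^ n by rewrite leq_pexp2l.
  by rewrite expn1 expnS; move: (B ^ n) => q; nia.
have reP k Y' w : n < k -> (forall i, i < n -> w i < b) ->
  (is_vec p b (B ^ k) n Y' /\ exists c, Y' = vec B n w + c * (B ^ k - B))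
  <-> Y' = vec (B ^ k) n w.
  move=> nk wb; rewrite BN; apply: rebaseP => //; first nia.
  by rewrite -BN => n0; apply: leN.
(* Each block has [n.+1] places, one more than [x] fills. *)
pose x' i := if i < n then x i else 0.
pose w k := x' (k %% N) * y (k %/ N).
have eXY : vec B n x * vec (B ^ N) n y = vec B (N * n) w.
  rewrite (vec_flatten B N n (fun i j => x' i * y j)) vecM.
  apply: eq_vec => j _; rewrite mulnC vecM [RHS]vecS /x' ltnn mul0n mul0n addn0.
  by apply: eq_vec => i ->; rewrite mulnC.
have ltN k : k < N * n -> k %% N < N /\ k %/ N < n.
  by move=> ltk; rewrite ltn_mod ltn_divLR // mulnC.
have wB k : k < N * n -> w k < B.
  move=> /ltN [_ /yb yk]; rewrite /w /x' /B; case: ifP => [/xb xk|_].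
    by apply: ltn_mul.
  by rewrite mul0n.
have mB k : k < N * n -> (if k %% N == k %/ N then 0 else B - 1) < B.
  by case: ifP; lia.
have domB u : dom p u (B - 1) <-> u < B by rewrite BE; apply: dom_pred.
split.
- move=> [Y' [Z' [O [c [d [[vY eY] [[vZ eZ] [eqW]]]]]]]].
  move: eqW; have -> : Y' = vec (B ^ N) n y by apply/reP => //; split=> //; exists c.
  have -> : Z' = vec (B ^ n.+2) n z by apply/reP => //; split=> //; exists d.
  rewrite eXY diag_vec maskE => eqW.
  rewrite [in X in dom _ _ X]BE; move/(dom_vec_inv p1); rewrite -BE => /(_ mB) [eO hO].
  move: eqW; rewrite eO vecD => eqW i lt_in.
  have lt_k : N * i + i < N * n by rewrite /N; nia.
  have modk : (N * i + i) %% N = i by rewrite mulnC modnMDl modn_small // /N; lia.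
  have divk : (N * i + i) %/ N = i by rewrite mulnC divnMDl // divn_small /N; lia.
  have sB k : k < N * n ->
      (if k %% N == k %/ N then z (k %/ N) else 0) + dig B O k < B.
    move=> lt_kN; have := hO _ lt_kN; have [_ /zb zk] := ltN _ lt_kN.
    case: ifP => _; first by move/(dom0 p1) => ->; lia.
    by move/domB; lia.
  have := vec_inj B0 wB sB eqW lt_k.
  rewrite /w modk divk eqxx /x' lt_in => ->.
  by have := hO _ lt_k; rewrite modk divk eqxx => /(dom0 p1) ->; rewrite addn0.
- move=> xyz; have /reP [] // := erefl (vec (B ^ N) n y).
  move=> vY [c eY]; have /reP [] // := erefl (vec (B ^ n.+2) n z).
  move=> vZ [d eZ].
  exists (vec (B ^ N) n y), (vec (B ^ n.+2) n z),
    (vec B (N * n) (fun k => if k %% N == k %/ N then 0 else w k)), c, d.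
  split=> //; split=> //; split.
    rewrite eXY diag_vec vecD; apply: eq_vec => k lt_k.
    have [_ lt_kn] := ltN _ lt_k; case: ifP => [/eqP eqk|_]; rewrite ?add0n //.
    by rewrite /w eqk /x' lt_kn xyz // addn0.
  rewrite maskE BE; apply/dom_vec => //; rewrite -BE => k lt_k.
  + by case: ifP => _ //; apply: wB.
  + exact: mB.
  + by case: ifP => _ //; apply/domB/wB.
Qed.

End Hadamard.

Lemma definable_apps K (I : K -> nat -> nat -> nat -> Prop) {addI : additive I}
    (P : env -> Prop) (ts : seq (env -> nat)) :
  definable I P -> foldr (fun t Q => defterm I t /\ Q) True ts ->
  definable I (fun v => P (fun i => nth (fun=> 0) ts i v)).
Proof.
move=> dP dts; apply: (definable_subst (t := nth (fun=> 0) ts)) => // i.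
elim: ts dts i => [|t ts IH] /= => [_ i|[dt dts] [|i]] //=.
  by rewrite nth_nil; apply: term_const.
exact: IH.
Qed.

(** * Definability from the digitwise order *)

Variant dom_symbol := DomOne | DomAdd | DomMul | DomDom.

Definition dom_interp (p : nat) (k : dom_symbol) (x y z : nat) : Prop :=
  match k with
  | DomOne => x = 1
  | DomAdd => x + y = z
  | DomMul => x * y = z
  | DomDom => dom p x y
  end.

#[global] Instance dom_additive p : additive (dom_interp p).
Proof.
split; first exact: (definable_atom (dom_interp p) DomAdd 0 1 2).
exact: (definable_atom (dom_interp p) DomOne 0 0 0).
Qed.

Lemma definable_atom_dom p t u : defterm (dom_interp p) t -> defterm (dom_interp p) u ->
  definable (dom_interp p) (fun v => dom p (t v) (u v)).
Proof.
apply: (definable_app2 (R := dom p)).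
exact: (definable_atom (dom_interp p) DomDom 0 1 0).
Qed.

Lemma dom_ppow_ring p : 1 < p -> ppow_ring p (dom_interp p).
Proof.
move=> p1.
have dmul : definable (dom_interp p) (fun v => v 0 * v 1 = v 2).
  exact: (definable_atom (dom_interp p) DomMul 0 1 2).
have tmul t u : defterm (dom_interp p) t -> defterm (dom_interp p) u ->
    defterm (dom_interp p) (fun v => t v * u v).
  apply: term_app2; apply: (@definable_ext _ _ (fun v => v 1 * v 2 = v 0)) => [v|].
    by split=> ->.
  exact: (definable_rename
    (fun j => if j is 0 then 1 else if j is 1 then 2 else 0) dmul).
split=> //; first exact: dom_additive.
apply: definable_ext => [v|]; first exact: ppow_domE.
by repeat (def_step || refine (definable_atom_dom _ _) || refine (tmul _ _ _ _)).
Qed.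

Lemma choose_below n (R : nat -> env -> Prop) :
  (forall i, i < n -> exists e, R i e) ->
  exists F, forall i, i < n -> R i (F i).
Proof.
elim: n => [|n IH] h; first by exists (fun _ _ => 0).
have [i lt_in|F hF] := IH; first by apply: h; apply: ltnW.
have [e he] := h n (ltnSn n).
exists (fun i => if i == n then e else F i) => i.
rewrite ltnS leq_eqVlt => /orP[/eqP ->|lt_in]; first by rewrite eqxx.
by rewrite ltn_eqF //; apply: hF.
Qed.

Lemma bounded_below n (f : nat -> nat) : exists M, forall i, i < n -> f i < M.
Proof.
exists (\sum_(i < n) f i).+1 => i lt_in.
by rewrite ltnS (bigD1 (Ordinal lt_in)) //= leq_addr.
Qed.

(** Telescoping; this makes definable the vector whose digits are the values of the bounded
    variable. *)
Lemma index_vecP B n y : 1 < B -> y = vec B n id <->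
  y * B + geo B n + B ^ n = y + n * B ^ n + 1.
Proof.
move=> B1; have vecE : vec B n id * B + geo B n + B ^ n = vec B n id + n * B ^ n + 1.
  elim: n => [|n IH]; first by rewrite /geo !vec0.
  by rewrite /geo !vecS -/(geo B n) expnS; move: IH; nia.
by split=> [-> //|]; move: (vec _ _ _) vecE => g; nia.
Qed.

(** * Elimination of bounded universal quantifiers *)

Section BoundedForall.

Variable p : nat.
Hypothesis p_prime : prime p.

Let p1 : 1 < p. Proof. exact: prime_gt1. Qed.

#[local] Instance dom_ppow_ring_instance : ppow_ring p (dom_interp p).
Proof. exact: dom_ppow_ring. Qed.

#[local] Ltac def_hook ::= match goal with
  | |- defterm _ (fun v => muln _ _) => refine (term_mul _ _)
  | |- defterm _ (fun v => subn _ _) => refine (term_sub _ _)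
  | |- defterm _ (fun v => expn _ _) => refine (term_exp p1 _ _)
  | |- definable _ (fun v => ppow _ _) => refine (definable_ppow _)
  | |- definable _ (fun v => dom _ _ _) => refine (definable_atom_dom _ _)
  end.

(** The guard [1 < E] makes [geo E n] the only solution of the equation for [U]. *)
Lemma definable_is_vec b E n X : defterm (dom_interp p) b ->
  defterm (dom_interp p) E -> defterm (dom_interp p) n -> defterm (dom_interp p) X ->
  definable (dom_interp p) (fun v => 1 < E v /\ is_vec p (b v) (E v) (n v) (X v)).
Proof.
move=> db dE dn dX.
have dR : definable (dom_interp p) (fun v => 1 < v 1 /\
    is_vec p (v 0) (v 1) (v 2) (v 3)).
  apply: (@definable_ext _ _ (fun v => 1 < v 1 /\ exists U,
    U * v 1 + 1 = v 1 ^ v 2 + U /\ dom p (v 3) ((v 0 - 1) * U))); last by def_tac.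
  move=> v; split=> -[E1 h]; split=> //.
    by exists (geo (v 1) (v 2)); split=> //; apply/geoP.
  by case: h => U [/(geoP _ _ E1) ->].
exact: (definable_apps (ts := [:: b; E; n; X]) dR).
Qed.

(** Digits below [b] are stored in base [b * b], which leaves room for a sum or a product of two
    digits. *)
Definition vatom (k : dom_symbol) (b n X Y Z : nat) : Prop :=
  let B := b * b in
  (1 < b /\ is_vec p b B n X /\ is_vec p b B n Y /\ is_vec p b B n Z) /\
  match k with
  | DomOne => X = geo B n
  | DomAdd => X + Y = Z
  | DomMul => hadamard p b n X Y Z
  | DomDom => dom p X Y
  end.

Lemma definable_vatom k b n X Y Z : defterm (dom_interp p) b ->
  defterm (dom_interp p) n -> defterm (dom_interp p) X -> defterm (dom_interp p) Y ->
  defterm (dom_interp p) Z ->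
  definable (dom_interp p) (fun v => vatom k (b v) (n v) (X v) (Y v) (Z v)).
Proof.
move=> db dn dX dY dZ.
suff dR : definable (dom_interp p) (fun v => vatom k (v 0) (v 1) (v 2) (v 3) (v 4)).
  exact: (definable_apps (ts := [:: b; n; X; Y; Z]) dR).
have gt1_exp b' k' : 1 < b' -> 1 < (b' * b') ^ k'.+1.
  move=> b'1; rewrite -[1](exp1n k'.+1) ltn_exp2r //; nia.
have dvec := definable_is_vec.
apply: (@definable_ext _ _ (fun v => let B := v 0 * v 0 in 1 < v 0 /\
  ((1 < B /\ is_vec p (v 0) B (v 1) (v 2)) /\ (1 < B /\ is_vec p (v 0) B (v 1) (v 3)) /\
  (1 < B /\ is_vec p (v 0) B (v 1) (v 4))) /\
  match k with
  | DomOne => v 2 * B + 1 = B ^ v 1 + v 2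
  | DomAdd => v 2 + v 3 = v 4
  | DomMul => exists Y' Z' O c d,
    ((1 < B ^ (v 1).+1 /\ is_vec p (v 0) (B ^ (v 1).+1) (v 1) Y') /\
       Y' = v 3 + c * (B ^ (v 1).+1 - B)) /\
    ((1 < B ^ (v 1).+2 /\ is_vec p (v 0) (B ^ (v 1).+2) (v 1) Z') /\
       Z' = v 4 + d * (B ^ (v 1).+2 - B)) /\
    v 2 * Y' = Z' + O /\ exists g1 g2 g3,
    (g1 * B + 1 = B ^ (v 1).+1 + g1 /\
     g2 * B ^ (v 1).+1 + 1 = (B ^ (v 1).+1) ^ v 1 + g2 /\
     g3 * B ^ (v 1).+2 + 1 = (B ^ (v 1).+2) ^ v 1 + g3) /\
    dom p O ((B - 1) * (g1 * g2 - g3))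
  | DomDom => dom p (v 2) (v 3)
  end)); last first.
  case: k => /=; by repeat (refine (dvec _ _ _ _ _ _ _ _) || def_step).
move=> v /=; rewrite /vatom.
set Q := match k with DomOne => _ | _ => _ end.
set Q' := match k with DomOne => _ | _ => _ end.
have QQ' : 1 < v 0 -> Q <-> Q'.
  move=> b1; rewrite {}/Q {}/Q'; case: k => //; first by apply: geoP; nia.
  have B1 : 1 < v 0 * v 0 by nia.
  split=> [[Y' [Z' [O [c [d [[h1 h2] [[h3 h4] [h5 h6]]]]]]]]|].
    exists Y', Z', O, c, d; split; first by split=> //; split=> //; apply: gt1_exp.
    split; first by split=> //; split=> //; apply: gt1_exp.
    split=> //; exists (geo (v 0 * v 0) (v 1).+1),
      (geo ((v 0 * v 0) ^ (v 1).+1) (v 1)), (geo ((v 0 * v 0) ^ (v 1).+2) (v 1)).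
    by split=> //; split; [|split]; apply/geoP => //; apply: gt1_exp.
  move=> [Y' [Z' [O [c [d [[[_ h1] h2] [[[_ h3] h4] [h5 h]]]]]]]].
  case: h => [g1 [g2 [g3 [[e1 [e2 e3]] h6]]]].
  move: h6; have -> := (geoP _ _ B1).2 e1.
  have -> := (geoP _ _ (gt1_exp _ (v 1) b1)).2 e2.
  have -> := (geoP _ _ (gt1_exp _ (v 1).+1 b1)).2 e3 => h6.
  by exists Y', Z', O, c, d.
split=> [[[b1 [hX [hY hZ]]] /(QQ' b1) hQ]|[b1 [[[B1 hX] [[_ hY] [_ hZ]]] /(QQ' b1) hQ]]] //.
have B1 : 1 < v 0 * v 0 by nia.
by do 5!split=> //.
Qed.

Lemma vatomP k l n x y z : 0 < l -> let b := p ^ l in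
  (forall i, i < n -> x i < b) -> (forall i, i < n -> y i < b) ->
  (forall i, i < n -> z i < b) ->
  vatom k b n (vec (b * b) n x) (vec (b * b) n y) (vec (b * b) n z) <->
  forall i, i < n -> dom_interp p k (x i) (y i) (z i).
Proof.
move=> l0 b xb yb zb; have b1 : 1 < b := digit_bound_gt1 p1 l0.
have B0 : 0 < b * b by nia.
have BE : b * b = p ^ (l + l) by rewrite expnD.
have lt_B (u : nat -> nat) : (forall i, i < n -> u i < b) -> forall i, i < n -> u i < b * b.
  by move=> ub i /ub; nia.
have isv (u : nat -> nat) : (forall i, i < n -> u i < b) -> is_vec p b (b * b) n (vec (b * b) n u).
  by move=> ub; rewrite BE; apply/is_vecP => //; [exact: leq_addr | exists u].
transitivity (match k with
  | DomOne => vec (b * b) n x = geo (b * b) n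
  | DomAdd => vec (b * b) n x + vec (b * b) n y = vec (b * b) n z
  | DomMul => hadamard p b n (vec (b * b) n x) (vec (b * b) n y) (vec (b * b) n z)
  | DomDom => dom p (vec (b * b) n x) (vec (b * b) n y)
  end).
  split=> [[_ //]|h]; split=> //; split=> //; split; first exact: isv.
  by split; exact: isv.
case: k => /=.
- split=> [|h]; last exact: eq_vec.
  by apply: vec_inj => // [|i _]; [exact: lt_B | nia].
- rewrite vecD; split=> [|h]; last exact: eq_vec.
  apply: vec_inj => //; last exact: lt_B.
  by move=> i lt_in; have := xb i lt_in; have := yb i lt_in; nia.
- exact: hadamardP.
- by rewrite BE; apply: dom_vec => //; rewrite -BE; exact: lt_B.
Qed.

Definition vholds (b n : nat) (w : var -> nat) (S : seq (atom dom_symbol)) : Prop :=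
  foldr (fun a Q => let: (k, (x, y, z)) := a in vatom k b n (w x) (w y) (w z) /\ Q)
    True S.

Lemma definable_vholds b n (w : var -> env -> nat) S : defterm (dom_interp p) b ->
  defterm (dom_interp p) n -> (forall x, defterm (dom_interp p) (w x)) ->
  definable (dom_interp p) (fun v => vholds (b v) (n v) (fun x => w x v) S).
Proof.
move=> db dn dw; elim: S => [|[k [[x y] z]] S IH] /=; first exact: definable_true.
by apply: definable_and IH; apply: definable_vatom.
Qed.

Lemma vholds_complete l n w (d : var -> nat -> nat) S m : 0 < l -> vars_lt m S ->
  (forall x, var_index x < m -> w x = vec (p ^ l * p ^ l) n (d x)) ->
  (forall x, var_index x < m -> forall i, i < n -> d x i < p ^ l) ->
  (forall i, i < n -> holds (dom_interp p) (d^~ i) S) -> vholds (p ^ l) n w S.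
Proof.
move=> l0 + hw hd; elim: S => [|[k [[x y] z]] S IH] //= [[hx hy hz] hS] h.
split; last by apply: IH => // i /h [].
rewrite !hw //; apply/vatomP => // [i|i|i|i /h [//]]; exact: hd.
Qed.

Lemma vholds_sound l n w d i S : 0 < l -> i < n ->
  (forall x, is_vec p (p ^ l) (p ^ l * p ^ l) n (w x) ->
     dig (p ^ l * p ^ l) (w x) i = d x) ->
  vholds (p ^ l) n w S -> holds (dom_interp p) d S.
Proof.
move=> l0 lt_in hd; elim: S => [|[k [[x y] z]] S IH] //= [ha /IH hS]; split=> //.
have [[b1 [hx [hy hz]]] _] := ha; move: ha.
rewrite -!hd //; set b := p ^ l in b1 hx hy hz *.
have BE : b * b = p ^ (l + l) by rewrite expnD.
have vecP X : is_vec p b (b * b) n X ->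
    exists2 u, forall j, j < n -> u j < b & X = vec (b * b) n u.
  by rewrite BE => /is_vecP; apply=> //; exact: leq_addr.
have [[u ub ->] [u' u'b ->] [u'' u''b ->]] := And3 (vecP _ hx) (vecP _ hy) (vecP _ hz).
move/vatomP => /(_ l0 ub u'b u''b i lt_in).
have lt_B (f : nat -> nat) : (forall j, j < n -> f j < b) -> forall j, j < n -> f j < b * b.
  by move=> fb j /fb; nia.
by rewrite !dig_vec //; solve [nia | exact: lt_B].
Qed.

(** The system is solved for all [i < v 0] at once: parameter [k.+1] becomes the constant vector
    [v k.+1 * U], the bounded variable the vector [N] of indices, and the witnesses the vectors
    [e j]. *)
Lemma definable_forall_var (P : env -> Prop) : definable (dom_interp p) P ->
  definable (dom_interp p) (fun v => forall i, i < v 0 -> P (scons i (fun j => v j.+1))).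
Proof.
move=> [S hS]; have [m hm] := vars_lt_exists S.
pose w (U N : nat) (v e : env) (x : var) : nat := match x with
  | inl 0 => N | inl k.+1 => v k.+1 * U | inr j => e j end.
apply: (@definable_ext _ _ (fun v => exists e, exists b U N,
  (ppow p b /\ 1 < b /\ v 0 < b) /\
  (U * (b * b) + 1 = (b * b) ^ v 0 + U /\
   N * (b * b) + U + (b * b) ^ v 0 = N + v 0 * (b * b) ^ v 0 + 1) /\
  vholds b (v 0) (w U N v e) S)); last first.
  apply: definable_exs; do 4!def_step; first by def_tac.
  def_step; first by def_tac.
  pose tw (x : var) (V : env) : nat := match x with
    | inl 0 => V 0 | inl k.+1 => V k.+1.*2.+3 * V 1 | inr j => V j.*2.+4 end.
  apply: (@definable_ext _ _ (fun V => vholds (V 2) (V 3) (fun x => tw x V) S)).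
    move=> V; rewrite /=.
    suff -> : w (V 1) (V 0) (fun i => V i.*2.+3) (fun i => V i.*2.+4) = tw^~ V by [].
    by apply: functional_extensionality => -[[|k]|j].
  apply: (definable_vholds (b := fun V => V 2) (n := fun V => V 3)); [by def_tac ..|].
  by case=> [[|k]|j]; [exact: (term_var 0) | exact: term_mul (term_var _) (term_var 1)
    | exact: (term_var j.*2.+4)].
move=> v; set n := v 0; split=> [h|].
- have {}h : forall i, i < n -> exists e, holds (dom_interp p)
      (join (scons i (fun j => v j.+1)) e) S by move=> i /h /hS.
  have [F hF] := choose_below h.
  have [M1 hM1] := bounded_below m.+1 v.
  (* [choose_below] yields environments, so the bound on the witnesses at [i] is stored in component
     [0]. *)
  have /choose_below [G hG] : forall i, i < n -> exists e : env,
      forall j, j < m -> F i j < e 0.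
    by move=> i _; have [M hM] := bounded_below m (F i); exists (fun=> M).
  have [M2 hM2] := bounded_below n (fun i => G i 0).
  (* [p ^ l] then exceeds all indices, all parameters occurring in [S] and all witnesses. *)
  pose l := n + M1 + M2 + 1; have l0 : 0 < l by rewrite /l; lia.
  have lt_l : l < p ^ l := ltn_expl l p1.
  have b1 : 1 < p ^ l := digit_bound_gt1 p1 l0.
  pose b := p ^ l; pose d (x : var) i := match x with
    | inl 0 => i | inl k.+1 => v k.+1 | inr j => F i j end.
  have B1 : 1 < b * b by rewrite /b; nia.
  exists (fun j => vec (b * b) n (d (inr j))), b, (geo (b * b) n), (vec (b * b) n id).
  split; first by split; [exists l | split=> //; rewrite /b; lia].
  split; first by split; [apply/geoP | apply/index_vecP].
  apply: (@vholds_complete l n _ d S m) => //.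
  + move=> [[|k]|j] _ //=; rewrite /geo vecM; apply: eq_vec => i _.
    by rewrite muln1.
  + move=> [[|k]|j] /= hx i lt_in; first by rewrite /l in lt_l *; lia.
      have := hM1 k.+1; rewrite ltnS => /(_ (ltnW hx)); rewrite /l in lt_l *; lia.
    have := hG i lt_in j hx; have := hM2 i lt_in; rewrite /l in lt_l *; lia.
- move=> [e [b [U [N [[[l eb] [b1 nb]] [[eU eN] hV]]]]]] i lt_in.
  have l0 : 0 < l by case: l eb b1 => // ->.
  have B1 : 1 < b * b by nia.
  have B0 : 0 < b * b := ltnW B1.
  have bB : b <= b * b by rewrite leq_pmulr // ltnW.
  have eU' := (geoP _ _ B1).2 eU; rewrite eU' in eN.
  have eN' := (index_vecP _ _ B1).2 eN.
  apply/hS; exists (fun j => dig (b * b) (e j) i).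
  move: hV; rewrite eb; apply: (@vholds_sound l n _ _ i) => //; rewrite -eb.
  case=> [[|k]|j] //=.
  + by move=> _; rewrite eN' (@dig_vec _ n id) // => j lt_j; exact: leq_trans (ltn_trans lt_j nb) bB.
  (* [is_vec] bounds [v k.+1 * geo] by [(b - 1) * geo], whence [v k.+1 < b]. *)
  + have geo0 : 0 < geo (b * b) n.
      by case: (n) lt_in => // n' _; rewrite /geo vecS mul1n addn_gt0 expn_gt0 (ltnW B1) orbT.
    rewrite eU' => /(dom_le p1); rewrite leq_pmul2r // => le_vb.
    rewrite /geo vecM (@dig_vec _ n (fun=> v k.+1 * 1)) ?muln1 // => j _.
    by rewrite (leq_trans _ bB) // (leq_ltn_trans le_vb) // subn1 ltn_predL ltnW.
Qed.

Lemma definable_forall (P : nat -> env -> Prop) t :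
  definable (dom_interp p) (fun v => P (v 0) (fun i => v i.+1)) ->
  defterm (dom_interp p) t ->
  definable (dom_interp p) (fun v => forall i, i < t v -> P i v).
Proof.
move=> /definable_forall_var dP dt.
apply: (definable_subst (t := fun i => if i is j.+1 then (fun v => v j) else t) dP).
by case=> [|j] //; apply: term_var.
Qed.

End BoundedForall.

(** * Recursive functions *)

Lemma definable_forall_fin K (I : K -> nat -> nat -> nat -> Prop) (T : finType)
    (P : T -> env -> Prop) :
  (forall x, definable I (P x)) -> definable I (fun v => forall x, P x v).
Proof.
move=> dP.
have dS (s : seq T) : definable I (fun v => forall x, x \in s -> P x v).
  elim: s => [|y s IH]; first by apply: definable_ext (definable_true I) => v; split.
  apply: definable_ext (definable_and (dP y) IH) => v; split=> [h|[hy h] x].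
    by split=> [|x xs]; apply: h; rewrite inE ?eqxx ?xs ?orbT.
  by rewrite inE => /orP[/eqP -> //|]; apply: h.
apply: definable_ext (dS (enum T)) => v.
by split=> h x; [move=> _; apply: h | apply: h; rewrite mem_enum].
Qed.

Lemma nth_mktuple_nat (v : nat -> nat) n j :
  j < n -> nth 0 [tuple v i | i < n] j = v j.
Proof.
by move=> lt_jn; have := nth_mktuple (fun i : 'I_n => v i) 0 (Ordinal lt_jn).
Qed.

Lemma behead_mktuple (v : nat -> nat) n :
  [tuple of behead [tuple v i | i < n.+1]] = [tuple v i.+1 | i < n].
Proof.
apply: eq_from_tnth => j; rewrite tnth_mktuple (tnth_nth 0) /= nth_behead.
by rewrite (nth_mktuple_nat v) // ltnS ltn_ord.
Qed.

Lemma cons_mktuple x (v : nat -> nat) n :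
  [tuple of x :: [tuple v i | i < n]] = [tuple scons x v i | i < n.+1].
Proof.
apply: eq_from_tnth => j; rewrite tnth_mktuple (tnth_nth 0) /=.
by case: j => -[|j] //= ltj; rewrite nth_mktuple_nat.
Qed.

Lemma thead_mktuple (v : nat -> nat) n : thead [tuple v i | i < n.+1] = v 0.
Proof. by rewrite /thead tnth_mktuple. Qed.

Section Recursive.

Variable p : nat.
Hypothesis p_prime : prime p.

Let p1 : 1 < p. Proof. exact: prime_gt1. Qed.

#[local] Instance dom_ppow_ring_rec : ppow_ring p (dom_interp p).
Proof. exact: dom_ppow_ring. Qed.

Notation I := (dom_interp p).

#[local] Ltac def_hook ::= match goal with
  | |- defterm _ (fun v => dig (S _) _ _) => refine (term_digS p1 _ _ _)
  end.

(* The values [h 0, ..., h n] of an iteration are coded as digits of a number. *)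
Lemma definable_iteration (A C : nat -> env -> Prop)
    (G : nat -> nat -> nat -> env -> Prop) t :
  definable I (fun v => A (v 0) (fun i => v i.+1)) ->
  definable I (fun v => G (v 0) (v 1) (v 2) (fun i => v i.+3)) ->
  definable I (fun v => C (v 0) (fun i => v i.+1)) -> defterm I t ->
  definable I (fun v => exists h : nat -> nat,
    [/\ A (h 0) v, forall i, i < t v -> G i (h i) (h i.+1) v & C (h (t v)) v]).
Proof.
move=> dA dG dC dt.
suff dn : definable I (fun v => exists h : nat -> nat,
    [/\ A (h 0) (fun i => v i.+1),
        forall i, i < v 0 -> G i (h i) (h i.+1) (fun i => v i.+1)
      & C (h (v 0)) (fun i => v i.+1)]).
  apply: (definable_subst (t := fun i => if i is j.+1 then (fun v => v j) else t) dn).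
  by case=> [|j] //; apply: term_var.
apply: (@definable_ext _ _ (fun v => exists P H,
  (exists x, x = dig P.+1 H 0 /\ A x (fun i => v i.+1)) /\
  (forall i, i < v 0 -> exists x y, x = dig P.+1 H i /\ y = dig P.+1 H i.+1 /\
     G i x y (fun i => v i.+1)) /\
  (exists x, x = dig P.+1 H (v 0) /\ C x (fun i => v i.+1)))).
  move=> v; split=> [[h [hA hG hC]]|[P [H [[_ [-> hA]] [hG [_ [-> hC]]]]]]].
    have [P hP] := bounded_below (v 0).+1 h.
    have hd i : i <= v 0 -> h i = dig P.+1 (vec P.+1 (v 0).+1 h) i.
      by move=> le_i; rewrite dig_vec // => j /hP; lia.
    exists P, (vec P.+1 (v 0).+1 h).
    split; first by exists (h 0); rewrite -hd.
    split=> [i lt_i|]; last by exists (h (v 0)); rewrite -hd.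
    by exists (h i), (h i.+1); rewrite -!hd ?(ltnW lt_i) //; do !split=> //; apply: hG.
  exists (dig P.+1 H); split=> // i /hG [_ [_ [-> [-> //]]]].
do 2!def_step; def_step.
  do 2!def_step; first by def_tac.
  exact: (definable_rename (fun i => if i is j.+1 then j.+4 else 0) dA).
def_step; last first.
  do 2!def_step; first by def_tac.
  exact: (definable_rename (fun i => if i is j.+1 then j.+4 else 0) dC).
apply: (definable_forall p_prime (P := fun i v => exists x y,
  x = dig (v 1).+1 (v 0) i /\ y = dig (v 1).+1 (v 0) i.+1 /\
  G i x y (fun i => v i.+3))); last exact: (term_var 2).
do 3!def_step; first by def_tac.
def_step; first by def_tac.
(* The quantifiers push [i], [x], [y] in reverse order, whence [2 - i]. *)
exact: (definable_rename (fun i => if i is j.+3 then j.+3.+3 else 2 - i) dG).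
Qed.

Lemma definable_rec_graph_app n (f : recfun n) (ts : nat -> env -> nat) r :
  definable I (fun v => rec_graph f [tuple v i | i < n] (v n)) ->
  (forall i, defterm I (ts i)) -> defterm I r ->
  definable I (fun v => rec_graph f [tuple ts i v | i < n] (r v)).
Proof.
move=> df dts dr.
apply: definable_ext (definable_subst
  (t := fun i => if i < n then ts i else r) df _) => [v|i]; last by case: ifP.
rewrite ltnn; suff -> : [tuple (if i < n then ts i else r) v | i < n] =
  [tuple ts i v | i < n] by [].
by apply: eq_from_tnth => i; rewrite !tnth_mktuple ltn_ord.
Qed.

(** Composition quantifies the intermediate values, primitive recursion is an iteration coded by
    digits, and minimisation takes one bounded universal quantifier. *)
Lemma definable_rec_graph n (f : recfun n) :
  definable I (fun v => rec_graph f [tuple v i | i < n] (v n)).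
Proof.
elim: f => {n} [n||n i|k n f IHf g IHg|n f IHf g IHg|n f IHf] /=.
- by def_tac.
- apply: (@definable_ext _ _ (fun v => v 1 = (v 0).+1)); last by def_tac.
  by move=> v; rewrite thead_mktuple.
- apply: (@definable_ext _ _ (fun v => v n = v i)); last by def_tac.
  by move=> v; rewrite tnth_mktuple.
- apply: (@definable_ext _ _ (fun v => exists e : env,
    (forall i : 'I_k, rec_graph (g i) [tuple v i | i < n] (e i)) /\
    rec_graph f [tuple e i | i < k] (v n))).
    move=> v; split=> [[w [hg hf]]|[e [hg hf]]].
      exists (fun i => nth 0 w i); split=> [i|]; first by rewrite -tnth_nth.
      suff -> : [tuple nth 0 w i | i < k] = w by [].
      by apply: eq_from_tnth => i; rewrite tnth_mktuple (tnth_nth 0).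
    by exists [tuple e i | i < k]; split=> // i; rewrite tnth_mktuple.
  apply: definable_exs; apply: definable_and.
    apply: definable_forall_fin => i.
    by apply: (definable_rec_graph_app (ts := fun i v => v i.*2)) => // [j|];
      apply: term_var.
  by apply: (definable_rec_graph_app (ts := fun i v => v i.*2.+1)) => // [j|];
    apply: term_var.
- apply: (@definable_ext _ _ (fun v => exists h : nat -> nat,
    [/\ rec_graph f [tuple v i.+1 | i < n] (h 0),
        forall i, i < v 0 ->
          rec_graph g [tuple scons i (scons (h i) (fun j => v j.+1)) j | j < n.+2] (h i.+1)
      & v n.+1 = h (v 0)])).
    move=> v; rewrite thead_mktuple.
    have eqT (T : n.+2.-tuple nat) i x :
        tval T = [:: i, x & behead [tuple v i | i < n.+1]] ->
        T = [tuple scons i (scons x (fun j => v j.+1)) j | j < n.+2].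
      move=> eT; rewrite -!cons_mktuple; apply: val_inj; rewrite /= eT.
      by have := congr1 val (behead_mktuple v n) => /= ->.
    split=> -[h [hf hg hr]]; exists h; (split=> //; last move=> i /hg).
    + by rewrite -behead_mktuple.
    + by congr (rec_graph g _ _); apply: eqT.
    + by rewrite behead_mktuple.
    + by congr (rec_graph g _ _); apply/esym/eqT.
  apply: (definable_iteration (t := fun v => v 0)
    (A := fun x v => rec_graph f [tuple v i.+1 | i < n] x)
    (G := fun i x y v =>
       rec_graph g [tuple scons i (scons x (fun j => v j.+1)) j | j < n.+2] y)
    (C := fun x v => v n.+1 = x)).
  + by apply: (definable_rec_graph_app (ts := fun i v => v i.+2)) => // [j|];
      apply: term_var.
  + apply: (definable_rec_graph_app (ts := fun i v =>
      scons (v 0) (scons (v 1) (fun j => v j.+4)) i)) => // [[|[|j]]|].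
    * exact: (term_var 0).
    * exact: (term_var 1).
    * exact: (term_var j.+4).
    * exact: (term_var 2).
  + by def_tac.
  + exact: (term_var 0).
- apply: (@definable_ext _ _ (fun v =>
    rec_graph f [tuple scons (v n) v i | i < n.+1] 0 /\
    forall i, i < v n -> exists m,
      rec_graph f [tuple scons i v j | j < n.+1] m.+1)).
    move=> v; rewrite cons_mktuple; split=> -[h0 h]; split=> // i /h [m];
      by rewrite cons_mktuple => hm; exists m.
  apply: definable_and.
    apply: (definable_rec_graph_app (ts := fun i v => scons (v n) v i)) => // [[|i]|].
    + exact: (term_var n).
    + exact: (term_var i).
    + exact: term_const.
  apply: (definable_forall p_prime (t := fun v => v n)
    (P := fun i v => exists m, rec_graph f [tuple scons i v j | j < n.+1] m.+1));
    last exact: term_var.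
  def_step; apply: (definable_rec_graph_app
    (ts := fun i v => scons (v 1) (fun j => v j.+2) i)) => // [[|i]|].
  + exact: (term_var 1).
  + exact: (term_var i.+2).
  + by def_tac.
Qed.

End Recursive.

(** * The diagonal sentence *)

Lemma div_ppow_ring p : prime p -> ppow_ring p (div_interp p).
Proof.
move=> p_prime; split; [exact: div_additive | exact: definable_div_mul |].
apply: (@definable_ext _ _ (fun v => divp p 1 (v 0))) => [v|].
  by rewrite divp_one.
by apply: definable_divp; def_tac.
Qed.

Lemma definable_dom_div p P : prime p ->
  definable (dom_interp p) P -> definable (div_interp p) P.
Proof.
move=> p_prime; have := div_ppow_ring p_prime => prI.
apply: definable_trans => -[] /=.
- by def_tac.
- by def_tac.
- exact: definable_div_mul.
- by apply: definable_dom => //; apply: term_var.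
Qed.

(** Doubling removes the halving, so the graph of [cpair] becomes polynomial. *)
Lemma double_cpair a b : cpair a b + cpair a b = (a + b) * (a + b).+1 + b + b.
Proof.
have even : ~~ odd ((a + b) * (a + b).+1) by rewrite oddM /= andbN.
rewrite /cpair addnACA addnn even_halfK //; lia.
Qed.

Fixpoint numeral k n : Defs.term k :=
  if n is m.+1 then TAdd (numeral k m) TOne else TZero.

Lemma term_val_numeral k (v : 'I_k -> nat) n : term_val v (numeral k n) = n.
Proof. by elim: n => //= n ->; rewrite addn1. Qed.

Lemma sat_eq_numeral p k (u : 'I_k -> nat) i c phi :
  sat p u (PAnd (PEq (TVar i) (numeral k c)) phi) <-> u i = c /\ sat p u phi.
Proof. by rewrite /= term_val_numeral. Qed.

Fixpoint numeral_code n : nat :=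
  if n is m.+1 then cpair 3 (cpair (numeral_code m) (cpair 2 0)) else cpair 1 0.

Lemma term_code_numeral k n : term_code (numeral k n) = numeral_code n.
Proof. by elim: n => //= n ->. Qed.

(** * Translation of systems into sentences *)

Section Sentences.

Variable m : nat.

(** Parameters take even places and quantified variables odd ones; the additional place provides
    [ord0] even when [m = 0]. *)
Definition var_ord (x : var) : 'I_m.*2.+1 :=
  inord match x with inl i => i.*2 | inr j => j.*2.+1 end.

Definition atom_form (a : atom div_symbol) : posform m.*2.+1 :=
  let: (k, (x, y, z)) := a in
  let T x := TVar (var_ord x) in
  match k with
  | DivOne => PEq (T x) TOne
  | DivAdd => PEq (TAdd (T x) (T y)) (T z)
  | DivDiv => PDiv (T x) (T y)
  end.

Definition system_form (S : seq (atom div_symbol)) : posform m.*2.+1 :=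
  foldr (fun a phi => PAnd (atom_form a) phi) (PEq TZero TZero) S.

Lemma sat_system_form p u S :
  sat p u (system_form S) <-> holds (div_interp p) (fun x => u (var_ord x)) S.
Proof. by elim: S => //= -[[] [[x y] z]] S IH /=; rewrite IH. Qed.

(** The sentence quantifies the parameters too, all but parameter [0] being left free. *)
Lemma sat_system_ex p S (c : nat) : vars_lt m S ->
  (exists u, u ord0 = c /\ sat p u (system_form S)) <->
  exists v e, v 0 = c /\ holds (div_interp p) (join v e) S.
Proof.
move=> hm; split=> [[u [<- /sat_system_form hS]]|[v [e [<- hS]]]].
  exists (fun i => u (inord i.*2)), (fun j => u (inord j.*2.+1)).
  split; first by congr u; apply: val_inj; rewrite /= inordK.
  by apply: holds_ext hS => -[].
exists (fun i => mix v e i); split=> //; apply/sat_system_form.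
apply: (holds_vars_lt hm) hS => -[i|j] /= lt_m.
- by rewrite inordK /mix ?odd_double ?doubleK // ltnS leq_double ltnW.
- by rewrite inordK /mix /= ?odd_double ?uphalf_double // ltnS ltn_double.
Qed.

End Sentences.

(* The code of [exists x, x_0 = c /\ phi] when [c] codes [exists x, phi]. *)
Definition instance_code (k phi c : nat) : nat :=
  cpair k (cpair 3 (cpair
    (cpair 0 (cpair (cpair 0 0) (numeral_code c))) phi)).

Definition diagonal (f : recfun 1) (c : nat) : Prop := exists k phi,
  c = cpair k phi /\ rec_graph f [tuple instance_code k phi c] 0.

Lemma definable_diagonal p f : prime p ->
  definable (dom_interp p) (fun v => diagonal f (v 0)).
Proof.
move=> p_prime; have p1 := prime_gt1 p_prime.
have prI := dom_ppow_ring p1.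
have dpair t u : defterm (dom_interp p) t -> defterm (dom_interp p) u ->
    defterm (dom_interp p) (fun v => cpair (t v) (u v)).
  apply: term_app2; apply: (@definable_ext _ _
    (fun v => v 0 + v 0 = (v 1 + v 2) * (v 1 + v 2).+1 + v 2 + v 2)) => [v|].
    by have := double_cpair (v 1) (v 2); lia.
  by repeat (def_step || refine (term_mul _ _)).
have dnum t : defterm (dom_interp p) t -> defterm (dom_interp p) (fun v => numeral_code (t v)).
  apply: term_app1; apply: (@definable_ext _ _ (fun v => exists h : nat -> nat,
    [/\ h 0 = cpair 1 0,
        forall i, i < v 1 -> h i.+1 = cpair 3 (cpair (h i) (cpair 2 0))
      & v 0 = h (v 1)])) => [v|].
    split=> [->|[h [h0 hS ->]]]; first by exists numeral_code.
    elim: (v 1) hS => [|n IH] hS //=; rewrite hS // IH // => i lt_in.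
    by apply: hS; apply: ltnW.
  apply: (definable_iteration p_prime (t := fun v => v 1)
    (A := fun x v => x = cpair 1 0)
    (G := fun i x y v => y = cpair 3 (cpair x (cpair 2 0)))
    (C := fun x v => v 0 = x));
  by repeat (def_step || refine (dpair _ _ _ _)).
rewrite /diagonal; do 2!def_step; def_step.
  by repeat (def_step || refine (dpair _ _ _ _)).
apply: (@definable_ext _ _ (fun v =>
  rec_graph f [tuple instance_code (v 1) (v 0) (v 2) | i < 1] 0)).
  move=> v; suff -> : [tuple instance_code (v 1) (v 0) (v 2)] =
    [tuple instance_code (v 1) (v 0) (v 2) | i < 1] by [].
  by apply: eq_from_tnth => i; rewrite tnth_mktuple (tnth_nth 0) ord1.
apply: (definable_rec_graph_app
  (ts := fun _ v => instance_code (v 1) (v 0) (v 2))).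
- exact: definable_rec_graph.
- move=> _; rewrite /instance_code.
  by repeat (def_step || refine (dnum _ _) || refine (dpair _ _ _ _)).
- exact: term_const.
Qed.

Theorem theorem2p1 (p : nat) (hp : prime p) : undecidable (Th_posex p).
Proof.
move=> [f hf].
have [S hS] := definable_dom_div hp (definable_diagonal f hp).
have [m hm] := vars_lt_exists S.
pose phi := system_form m S.
pose c := sentence_code (PosEx phi).
pose s := PosEx (PAnd (PEq (TVar ord0) (numeral m.*2.+1 c)) phi).
have code_s : sentence_code s = instance_code m.*2.+1 (posform_code phi) c.
  by rewrite /s /sentence_code /= term_code_numeral.
have diag_c : diagonal f c <-> rec_graph f [tuple sentence_code s] 0.
  rewrite code_s; split=> [[k [psi [/cpair_inj /= [<- <-] //]]]|h].
  by exists m.*2.+1, (posform_code phi).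
have true_s : Th_posex p s <-> diagonal f c.
  transitivity (exists v e, v 0 = c /\ holds (div_interp p) (join v e) S).
    rewrite -(sat_system_ex p c hm) /Th_posex.
    by split=> -[u hu]; exists u; apply/sat_eq_numeral.
  split=> [|h]; first by move=> [v [e [ev he]]]; rewrite -ev; apply/hS; exists e.
  by have [e he] := (hS (fun=> c)).1 h; exists (fun=> c), e.
have [true_f false_f] := hf (sentence_code s).
(* If true, [s] is accepted by [f], yet it asserts that [f] rejects its code; [f] has only one value
   there. *)
have not_s : ~ Th_posex p s.
  move=> hs; have f0 := diag_c.1 (true_s.1 hs).
  by have := rec_graph_fun (true_f (ex_intro2 _ _ s hs erefl)) f0.
(* Being false, [s] is rejected by [f], which is what it asserts; injectivity of the coding keeps
   other true sentences from sharing its code. *)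
apply: (not_s); apply/true_s/diag_c/false_f => -[s' hs' /sentence_code_inj eq_s].
by apply: not_s; rewrite -eq_s.
Qed.
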